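(* Let $\Lambda$ be a weight function on $\mathbb{R}^{2n}$, $m\in\mathbb{R}$, $\rho\in(0,1]$, $N\in\mathbb{N}$, and let $A$ be the pseudo-differential operator with regular symbol $(a_\epsilon)_\epsilon\in\mathcal{S}^m_{\Lambda,\rho,N}$. Then $A$ maps $\mathcal{G}_{\tau,\mathcal{S}}(\mathbb{R}^n)$ into $\mathcal{G}_{\tau,\mathcal{S}}(\mathbb{R}^n)$ and $\mathcal{G}^\infty_{\mathcal{S}}(\mathbb{R}^n)$ into $\mathcal{G}^\infty_{\mathcal{S}}(\mathbb{R}^n)$.
   Context: Notation: $\langle x\rangle=(1+|x|^2)^{1/2}$, $\hat f(\xi)=\int e^{-ix\xi}f(x)\,dx$. $f(z)\prec g(z)$ on a set means $f\le c\,g$ there with a constant $c>0$ independent of $z$; $f\sim g$ means both $f\prec g$ and $g\prec f$. $\mathcal{E}[\mathbb{R}^p]$ is the algebra of all nets $(u_\epsilon)_{\epsilon\in(0,1]}$ with $u_\epsilon\in\mathcal{C}^\infty(\mathbb{R}^p)$. $\mathcal{E}_\tau(\mathbb{R}^n)$ is the set of $(u_\epsilon)_\epsilon\in\mathcal{E}[\mathbb{R}^n]$ such that for all $\alpha$ there is $N\in\mathbb{N}$ with $\sup_\epsilon\epsilon^N\|\langle x\rangle^{-N}\partial^\alpha u_\epsilon\|_{L^\infty}<\infty$; $\mathcal{N}_{\mathcal{S}}(\mathbb{R}^n)$ is the set of those such that for all $\alpha,\beta$ and all $q\in\mathbb{N}$, $\sup_\epsilon\epsilon^{-q}\|x^\alpha\partial^\beta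 u_\epsilon\|_{L^\infty}<\infty$; $\mathcal{E}^\infty_{\mathcal{S}}(\mathbb{R}^n)$ is the set of those for which there is $N\in\mathbb{N}$ such that for all $\alpha,\beta$, $\sup_\epsilon\epsilon^{N}\|x^\alpha\partial^\beta u_\epsilon\|_{L^\infty}<\infty$. $\mathcal{G}_{\tau,\mathcal{S}}(\mathbb{R}^n)=\mathcal{E}_\tau(\mathbb{R}^n)/\mathcal{N}_{\mathcal{S}}(\mathbb{R}^n)$, $\mathcal{G}^\infty_{\mathcal{S}}(\mathbb{R}^n)=\mathcal{E}^\infty_{\mathcal{S}}(\mathbb{R}^n)/\mathcal{N}_{\mathcal{S}}(\mathbb{R}^n)$. Mollifier: $\varphi\in\mathcal{S}(\mathbb{R}^n)$ is fixed with $\int\varphi\,dx=1$ and $\int x^\alpha\varphi\,dx=0$ for all $\alpha\neq0$; $\varphi_\epsilon(x)=\epsilon^{-n}\varphi(x/\epsilon)$, so $\widehat{\varphi_\epsilon}(y)=\hat\varphi(\epsilon y)$. Weight function: a continuous real function $\Lambda$ on $\mathbb{R}^{2n}$ such that (i) there is $\mu>0$ with $\langle z\rangle^\mu\prec\Lambda(z)\prec\langle z\rangle$; (ii) $\Lambda(z)\sim\Lambda(\zeta)$ on $\{|\zeta-z|\le\mu\Lambda(z)\}$; (iii) for all $t\in\mathbb{R}^{2n}$, $\Lambda(t_1z_1,\dots,t_{2n}z_{2n})\prec\Lambda(z)$. Regular symbols: $\mathcal{S}^m_{\Lambda,\rho,N}$ is the set of $(a_\epsilon)_\epsilon\in\mathcal{E}[\mathbb{R}^{2n}]$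 such that for all $\alpha\in\mathbb{N}^{2n}$ there is $c>0$ with $|\partial^\alpha a_\epsilon(z)|\le c\Lambda(z)^{m-\rho|\alpha|}\epsilon^{-N}$ for all $\epsilon\in(0,1]$, $z=(x,\xi)\in\mathbb{R}^{2n}$ ($N$ independent of $\alpha$). Pseudo-differential operator with symbol $(a_\epsilon)_\epsilon$: the linear map sending the class of $(u_\epsilon)_\epsilon$ to the class of $A_\epsilon u_\epsilon(x)=(2\pi)^{-n}\int_{\mathbb{R}^{2n}}e^{i(x-y)\xi}a_\epsilon(x,\xi)u_\epsilon(y)\widehat{\varphi_\epsilon}(y)\,dy\,d\xi$ (for each $\epsilon$, an oscillatory integral, equal to the iterated integral $(2\pi)^{-n}\int e^{ix\xi}a_\epsilon(x,\xi)\widehat{(u_\epsilon\widehat{\varphi_\epsilon})}(\xi)\,d\xi$). *)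

(* Defs.v *)
(* Points of R^n are row vectors 'rV[R]_n, complex numbers are R[i], and the
   point (x, xi) of R^2n is row_mx x xi : 'rV[R]_(n + n). *)
From HB Require Import structures.
From mathcomp Require Import all_boot all_order all_algebra.
From mathcomp Require Import all_classical all_reals all_analysis.
From mathcomp Require Import complex.

Set Implicit Arguments.
Unset Strict Implicit.
Unset Printing Implicit Defensive.

Import Order.TTheory GRing.Theory Num.Theory.
Import numFieldNormedType.Exports.

Local Open Scope classical_set_scope.
Local Open Scope ring_scope.
Local Open Scope complex_scope.

(* The product sigma-algebra is carried by n.-tuple and the normed structure by
   'rV; rowt identifies the two.  The measure is built by
   recursion as the image of the product measure under R * R^n -> R^n.+1. *)
Section lebesgue_Rn.
Variable R : realType.

Definition Rtuple (n : nat) := n.-tuple (measurableTypeR R).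

Definition rowt (n : nat) (t : Rtuple n) : 'rV[R]_n := \row_i tnth t i.

Definition consR (n : nat) (p : measurableTypeR R * Rtuple n) : Rtuple n.+1 :=
  [tuple of p.1 :: p.2].

Lemma measurable_consR (n : nat) : measurable_fun setT (@consR n).
Proof. exact: measurable_cons measurable_fst measurable_snd. Qed.

Section lebesgue_succ.
Local Open Scope ereal_scope.
Variables (n : nat) (mu : {sigma_finite_measure set (Rtuple n) -> \bar R}).

Let leb : {sigma_finite_measure set (measurableTypeR R) -> \bar R} :=
  lebesgue_measure.

Definition lebesgue_succ : set (Rtuple n.+1) -> \bar R :=
  pushforward (leb \x mu) (@consR n).

Let mconsR := @measurable_consR n.

Let lebesgue_succ0 : lebesgue_succ set0 = 0.
Proof. by rewrite /lebesgue_succ /pushforward preimage_set0 measure0. Qed.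

Let lebesgue_succ_ge0 A : 0 <= lebesgue_succ A.
Proof. exact: measure_ge0. Qed.

Let lebesgue_succ_additive : semi_sigma_additive lebesgue_succ.
Proof. exact: measure_semi_sigma_additive. Qed.

HB.instance Definition _ := isMeasure.Build _ _ _ lebesgue_succ
  lebesgue_succ0 lebesgue_succ_ge0 lebesgue_succ_additive.

Let lebesgue_succ_sigma_finite : sigma_finite setT lebesgue_succ.
Proof.
have /sigma_finiteP[F [TF ndF Foo]] := sigma_finiteT leb.
have /sigma_finiteP[G [TG ndG Goo]] := sigma_finiteT mu.
pose uncons (t : Rtuple n.+1) : measurableTypeR R * Rtuple n :=
  (thead t, [tuple of behead t]).
have unconsK p : uncons (consR p) = p.
  by case: p => x t; rewrite /uncons theadE; congr pair; exact/val_inj.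
have muncons : measurable_fun setT uncons.
  by apply: measurable_fun_pair; [exact: measurable_tnth|exact: measurable_behead].
exists (fun i => uncons @^-1` (F i `*` G i)).
  apply/esym; rewrite -subTset => t _.
  have [i _ Fi] : (\bigcup_i F i) (uncons t).1 by rewrite -TF.
  have [j _ Gj] : (\bigcup_j G j) (uncons t).2 by rewrite -TG.
  exists (maxn i j) => //; split.
    by move: Fi; exact/subsetPset/ndF/leq_maxl.
  by move: Gj; exact/subsetPset/ndG/leq_maxr.
move=> i; have [mF Fi] := Foo i; have [mG Gi] := Goo i; split.
  by rewrite -[X in measurable X]setTI; apply: muncons => //; exact: measurableX.
rewrite /lebesgue_succ /pushforward -comp_preimage.
have -> : uncons \o @consR n = id by apply/funext => p; exact: unconsK.
by rewrite preimage_id product_measure1E// lte_mul_pinfty// ge0_fin_numE.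
Qed.

HB.instance Definition _ := Measure_isSigmaFinite.Build _ _ _ lebesgue_succ
  lebesgue_succ_sigma_finite.

End lebesgue_succ.

Fixpoint lebesgue_Rn (n : nat) : {sigma_finite_measure set (Rtuple n) -> \bar R} :=
  match n with
  | 0 => \d_([tuple] : Rtuple 0)
  | k.+1 => lebesgue_succ (lebesgue_Rn k)
  end.

Definition cintegral (n : nat) (f : 'rV[R]_n -> R[i]) : R[i] :=
  (\int[lebesgue_Rn n]_t complex.Re (f (rowt t))) +i*
  (\int[lebesgue_Rn n]_t complex.Im (f (rowt t))).

Definition Linfty_norm (n : nat) (f : 'rV[R]_n -> R[i]) : \bar R :=
  Lnorm (lebesgue_Rn n) +oo%E (fun t => (Normc.normc (f (rowt t)))%:E).

End lebesgue_Rn.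

Section calculus.
Variables (R : realType) (n : nat).
Implicit Types (x y : 'rV[R]_n) (f : 'rV[R]_n -> R) (u : 'rV[R]_n -> R[i]).

Definition dotrv x y : R := \sum_i x 0 i * y 0 i.

(* The library norm on 'rV is the sup norm. *)
Definition euclid_norm x : R := Num.sqrt (dotrv x x).

Definition japanese x : R := Num.sqrt (1 + euclid_norm x ^+ 2).

Definition multi_index := {ffun 'I_n -> nat}.

Definition mi_size (alpha : multi_index) : nat := (\sum_i alpha i)%N.

Definition monomial (alpha : multi_index) x : R := \prod_i x 0 i ^+ alpha i.

Definition partial (i : 'I_n) f : 'rV[R]_n -> R :=
  fun x => 'D_(delta_mx 0 i) f x.

Fixpoint of_class_C (k : nat) f : Prop :=
  match k with
  | 0 => continuous f
  | k'.+1 => continuous f /\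
      forall i, (forall x, derivable f x (delta_mx 0 i)) /\
                of_class_C k' (partial i f)
  end.

Definition smooth u : Prop :=
  forall k, of_class_C k (@complex.Re R \o u) /\ of_class_C k (@complex.Im R \o u).

Definition mi_partial (alpha : multi_index) f : 'rV[R]_n -> R :=
  foldr (fun i g => iter (alpha i) (partial i) g) f (enum 'I_n).

Definition cpartial (alpha : multi_index) u : 'rV[R]_n -> R[i] :=
  fun x => mi_partial alpha (@complex.Re R \o u) x +i*
           mi_partial alpha (@complex.Im R \o u) x.

Definition schwartz u : Prop :=
  smooth u /\
  forall alpha beta : multi_index,
    (Linfty_norm (fun x => (monomial alpha x)%:C * cpartial beta u x)%R
      < +oo)%E.

Definition cexpi (t : R) : R[i] := cos t +i* sin t.

Definition fourier u : 'rV[R]_n -> R[i] :=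
  fun xi => cintegral (fun x => cexpi (- dotrv x xi) * u x).

End calculus.

Definition eps_index (R : realType) := {e : R | 0 < e <= 1}.

Definition net (R : realType) (n : nat) := eps_index R -> 'rV[R]_n -> R[i].

Section nets.
Variables (R : realType) (n : nat).
Implicit Types (u v : net R n) (alpha beta : multi_index n).

Definition sup_eps (h : eps_index R -> \bar R) : \bar R := ereal_sup (range h).

Definition smooth_net : set (net R n) := [set u | forall e, smooth (u e)].

Definition Etau : set (net R n) := [set u | smooth_net u /\
  forall alpha, exists N : nat,
    (sup_eps (fun e => (val e ^+ N)%:E *
      Linfty_norm (fun x => (japanese x ^- N)%:C * cpartial alpha (u e) x)%R)
     < +oo)%E].

Definition NegS : set (net R n) := [set u | smooth_net u /\
  forall alpha beta (q : nat),
    (sup_eps (fun e => (val e ^- q)%:E *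
      Linfty_norm (fun x => (monomial alpha x)%:C * cpartial beta (u e) x)%R)
     < +oo)%E].

Definition EinftyS : set (net R n) := [set u | smooth_net u /\
  exists N : nat, forall alpha beta,
    (sup_eps (fun e => (val e ^+ N)%:E *
      Linfty_norm (fun x => (monomial alpha x)%:C * cpartial beta (u e) x)%R)
     < +oo)%E].

Definition lincomb (c : R[i]) u v : net R n := fun e x => c * u e x + v e x.

(* Elements of the quotients are cosets u + NegS. *)
Definition classS u : set (net R n) :=
  [set v | NegS (fun e x => v e x - u e x)].

Definition GtauS : set (set (net R n)) := classS @` Etau.

Definition GinftyS : set (set (net R n)) := classS @` EinftyS.

End nets.

Section mollifier.
Variables (R : realType) (n : nat).

Definition mollifier (phi : 'rV[R]_n -> R[i]) : Prop :=
  [/\ schwartz phi,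
      cintegral phi = 1 &
      forall alpha : multi_index n, alpha <> [ffun=> 0%N] ->
        cintegral (fun x => (monomial alpha x)%:C * phi x) = 0].

Definition scaled (phi : 'rV[R]_n -> R[i]) : net R n :=
  fun e x => (val e ^- n)%:C * phi ((val e)^-1 *: x).

End mollifier.

Definition prec (R : realType) (T : Type) (D : set T) (f g : T -> R) : Prop :=
  exists2 c : R, 0 < c & forall z, D z -> f z <= c * g z.

(* The constant in the last condition may depend on t. *)
Definition weight_function (R : realType) (p : nat) (Lambda : 'rV[R]_p -> R)
    : Prop :=
  continuous Lambda /\
  exists mu : R, [/\ 0 < mu,
    prec setT (fun z => japanese z `^ mu) Lambda /\
      prec setT Lambda (@japanese R p),
    (let D := [set w : 'rV[R]_p * 'rV[R]_p |
                 euclid_norm (w.2 - w.1) <= mu * Lambda w.1] in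
     prec D (fun w => Lambda w.1) (fun w => Lambda w.2) /\
     prec D (fun w => Lambda w.2) (fun w => Lambda w.1)) &
    forall t : 'rV[R]_p,
      prec setT (fun z : 'rV[R]_p => Lambda (\row_i (t 0 i * z 0 i))) Lambda].

Section operators.
Variables (R : realType) (n : nat).

Definition regular_symbol (Lambda : 'rV[R]_(n + n) -> R) (m rho : R) (N : nat)
    : set (net R (n + n)) := [set a | smooth_net a /\
  forall alpha : multi_index (n + n), exists2 c : R, 0 < c &
    forall e z, Normc.normc (cpartial alpha (a e) z) <=
      c * Lambda z `^ (m - rho * (mi_size alpha)%:R) * val e ^- N].

(* The oscillatory integral is taken in its iterated form: first in y (a Fourier
   transform), then in xi. *)
Definition psido_net (phi : 'rV[R]_n -> R[i]) (a : net R (n + n))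
    (u : net R n) : net R n :=
  fun e x => ((2 * pi) ^- n)%:C * cintegral (fun xi : 'rV[R]_n =>
    cexpi (dotrv x xi) * a e (row_mx x xi) *
    fourier (fun y => u e y * fourier (scaled phi e) y) xi).

(* A is a linear map on the classes of Etau nets sending the class of u to the
   class of psido_net phi a u; linearity is written on representatives. *)
Definition psido_operator (phi : 'rV[R]_n -> R[i]) (a : net R (n + n))
    (A : set (net R n) -> set (net R n)) : Prop :=
  (forall u, Etau u -> A (classS u) = classS (psido_net phi a u)) /\
  (forall (c : R[i]) u v, Etau u -> Etau v ->
     A (classS (lincomb c u v)) =
     classS (lincomb c (psido_net phi a u) (psido_net phi a v))).

End operators.

(* Main.v *)
(* For each eps, A_eps u_eps is T(a_eps, F(u_eps phihat_eps)), where
   T(a, h)(x) = int e^{i x.xi} a(x, xi) h(xi) dxi and F is itself T(1, .) up to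
   a reflection.  If a and all its derivatives are O((<x><xi>)^M) with M
   independent of the derivative (which holds since rho > 0, Lambda is bounded
   below and Lambda <= c <z>), then T(a, .) is continuous on Schwartz functions:
   derivatives in x only bring powers of xi, absorbed by the decay of h, and
   integrating by parts in xi turns powers of x into derivatives of a and h,
   which beat <x>^M.  The bounds are linear in the constants of a and of h.

   The mollifier enters in two ways.  phihat_eps decays rapidly with constants
   eps^-N_k, so u_eps phihat_eps is Schwartz as soon as u is in Etau.  All its
   derivatives are O(eps^-n), uniformly in their order, so multiplication by
   phihat_eps preserves a uniform rate eps^-N or eps^q up to the fixed loss
   eps^-n; this gives EinftyS and the stability of NegS, hence a well-defined map
   on classes. *)
Require Import Defs.
From HB Require Import structures.
From mathcomp Require Import all_boot all_order all_algebra.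
From mathcomp Require Import all_classical all_reals all_analysis.
From mathcomp Require Import measurable_realfun ess_sup_inf complex ring lra.
Import Order.TTheory GRing.Theory Num.Theory.
Import numFieldNormedType.Exports.
Set Implicit Arguments.
Unset Strict Implicit.
Unset Printing Implicit Defensive.
Local Open Scope classical_set_scope.
Local Open Scope ring_scope.
Local Open Scope complex_scope.

(** * Partial derivatives *)

(** The estimates are real-variable ones. The real and imaginary parts of the integrand of T(a, h)
    are sums of kernels cos(x.y + th) b(x, y) g(y); differentiating in x and integrating by parts in
    y shift [th] by multiples of pi/2, so this family is closed under everything the proof does. The
    delicate point is the bookkeeping of orders. The number of derivatives of h used to bound T(a,
    h) depends on M and on the decay wanted, but not on the number of derivatives wanted. For the
    Fourier transform (M = 0) and no decay it is zero; since a derivative of phi_eps costs a factor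
    1/eps, this is the origin of the uniform rate eps^-n of phihat_eps. Hence the explicit orders in
    all seminorms, and constants quantified before the functions: each estimate is applied eps by
    eps. The weight prod (1 + x_i^2) lets integration by parts proceed one coordinate at a time. The
    norms of the definitions are essential suprema; they control the value at every point because
    the functions are continuous and nonempty open sets have positive measure. *)

Section words.
Variables (R : realType) (n : nat).
Implicit Types (f g : 'rV[R]_n -> R) (w v : seq 'I_n) (x : 'rV[R]_n).

Definition smoothr f := forall k, of_class_C k f.

(** The two difference quotients are the same function of h. One-variable results (mean value
    theorem, chain rule, differentiation under the integral) thereby apply along lines of R^n. *)
Lemma is_derive_lineP f (x v : 'rV[R]_n) (s d : R) :
  is_derive (x + s *: v) v f d <-> is_derive s 1 (fun s : R => f (x + s *: v)) d.
Proof.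
have E : (fun h : R => h^-1 *: (f (x + (h *: (1 : R) + s) *: v) - f (x + s *: v)))
   = (fun h : R => h^-1 *: (f (h *: v + (x + s *: v)) - f (x + s *: v))).
  apply/funext => h; congr (_ *: (f _ - _)).
  by rewrite [h *: 1]mulr1 scalerDl addrCA.
by split=> -[d1 d2]; apply: DeriveDef;
  move: d1 d2; rewrite /derivable /derive ?E// -E.
Qed.

Lemma is_derive_line f (x v : 'rV[R]_n) (s : R) :
  derivable f (x + s *: v) v ->
  is_derive s 1 (fun s : R => f (x + s *: v)) ('D_v f (x + s *: v)).
Proof. by move=> /derivableP /is_derive_lineP. Qed.

Lemma of_class_CS k f : of_class_C k.+1 f -> of_class_C k f.
Proof.
elim: k f => [f [] //|k IH f [cf Hf]]; split => // i.
by have [? /IH] := Hf i.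
Qed.

Lemma smoothrP f : smoothr f <->
  continuous f /\ forall i, (forall x, derivable f x (delta_mx 0 i)) /\
    smoothr (partial i f).
Proof.
split=> [sf|[cf Hf] [|k] //=].
  split; first exact: (sf 0%N).
  move=> i; have [_ /(_ i)[? _]] := sf 1%N; split=> // k.
  by have [_ /(_ i)[_ ?]] := sf k.+1.
by split => // i; have [? ?] := Hf i; split => //.
Qed.

Lemma smoothr_continuous f : smoothr f -> continuous f.
Proof. by move=> /(_ 0%N). Qed.

Lemma smoothr_derivable f x i : smoothr f -> derivable f x (delta_mx 0 i).
Proof. by move=> /smoothrP[_ /(_ i)[]]. Qed.

Arguments smoothr_derivable {f} x i _.

Lemma smoothr_partial f i : smoothr f -> smoothr (partial i f).
Proof. by move=> /smoothrP[_ /(_ i)[]]. Qed.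

Lemma partialD f g i : smoothr f -> smoothr g ->
  partial i (fun x => f x + g x) = (fun x => partial i f x + partial i g x).
Proof.
by move=> sf sg; apply/funext => x; rewrite /partial;
  apply: (@deriveD _ _ _ f g); exact: smoothr_derivable.
Qed.

Lemma partialM f g i : smoothr f -> smoothr g ->
  partial i (fun x => f x * g x) =
  (fun x => partial i f x * g x + f x * partial i g x).
Proof.
move=> sf sg; apply/funext => x.
have [df dg] := (smoothr_derivable x i sf, smoothr_derivable x i sg).
apply: etrans (@deriveM _ _ f g x _ df dg) _; rewrite addrC.
by congr (_ + _); exact: mulrC.
Qed.

Lemma partial_cst (c : R) i : partial i (fun _ : 'rV[R]_n => c) = (fun _ => 0).
Proof. by apply/funext => x; exact: derive_cst. Qed.

Lemma of_class_C_cst k (c : R) : of_class_C k (fun _ : 'rV[R]_n => c).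
Proof.
elim: k c => [|k IH] c /=; first exact: cst_continuous.
split=> [|i]; first exact: cst_continuous.
split=> [x|]; first exact: (@derivable_cst R 'rV[R]_n R c).
by rewrite partial_cst.
Qed.

Lemma of_class_CD k f g : of_class_C k f -> of_class_C k g ->
  of_class_C k (fun x => f x + g x).
Proof.
elim: k f g => [|k IH] f g /=.
  by move=> cf cg x; exact: (continuousD (cf x) (cg x)).
move=> [cf df] [cg dg]; split=> [x|j].
  exact: (continuousD (cf x) (cg x)).
have [df0 df1] := df j; have [dg0 dg1] := dg j.
split=> [x|]; first exact: (@derivableD _ _ _ f g).
rewrite (_ : partial _ _ = fun x => partial j f x + partial j g x); first exact: IH.
by apply/funext => x; exact: (@deriveD _ _ _ f g).
Qed.

Lemma of_class_CM k f g : of_class_C k f -> of_class_C k g ->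
  of_class_C k (fun x => f x * g x).
Proof.
elim: k f g => [|k IH] f g sf sg /=.
  by move=> x; exact: (continuousM (sf x) (sg x)).
have [cf df] := sf; have [cg dg] := sg.
split=> [x|i]; first exact: (continuousM (cf x) (cg x)).
have [df1 df2] := df i; have [dg1 dg2] := dg i.
split=> [x|]; first exact: (@derivableM _ _ f g).
rewrite (_ : partial _ _ =
    fun x => partial i f x * g x + f x * partial i g x).
  by apply: of_class_CD; apply: IH => //; exact: of_class_CS.
apply/funext => x.
apply: etrans (@deriveM _ _ f g x _ (df1 x) (dg1 x)) _; rewrite addrC.
by congr (_ + _); exact: mulrC.
Qed.

Lemma smoothr_cst (c : R) : smoothr (fun _ => c).
Proof. by move=> k; exact: of_class_C_cst. Qed.

Lemma smoothrD f g : smoothr f -> smoothr g -> smoothr (fun x => f x + g x).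
Proof. by move=> sf sg k; exact: of_class_CD. Qed.

Lemma smoothrM f g : smoothr f -> smoothr g -> smoothr (fun x => f x * g x).
Proof. by move=> sf sg k; exact: of_class_CM. Qed.

Lemma smoothrZ (c : R) f : smoothr f -> smoothr (fun x => c * f x).
Proof. by move=> sf; apply: smoothrM => //; exact: smoothr_cst. Qed.

Lemma partialZ (c : R) f i : smoothr f ->
  partial i (fun x => c * f x) = (fun x => c * partial i f x).
Proof.
move=> sf; rewrite partialM//; last exact: smoothr_cst.
by rewrite partial_cst; apply/funext => x; rewrite mul0r add0r.
Qed.

Lemma is_derive_coord (x v : 'rV[R]_n) (j : 'I_n) :
  is_derive x v (fun x : 'rV[R]_n => x 0 j) (v 0 j).
Proof.
have := (is_derive_lineP (fun x : 'rV[R]_n => x 0 j) x v 0 (v 0 j)).2.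
rewrite scale0r addr0; apply.
rewrite [X in is_derive _ _ X _](_ : _ = cst (x 0 j) + id * cst (v 0 j)).
  have H := is_deriveD (is_derive_cst (x 0 j) (0 : R) (1 : R))
    (is_deriveM (is_derive_id (0 : R) (1 : R)) (is_derive_cst (v 0 j) (0 : R) (1 : R))).
  apply: is_derive_eq H _.
  by rewrite scaler0 !add0r; exact: mulr1.
by apply/funext => s; rewrite !mxE.
Qed.

Lemma partial_coord (i j : 'I_n) :
  partial i (fun x : 'rV[R]_n => x 0 j) = (fun _ => (i == j)%:R).
Proof.
apply/funext => x; have [_] := is_derive_coord x (delta_mx 0 i) j.
by rewrite /partial => ->; rewrite mxE eqxx eq_sym.
Qed.

Lemma smoothr_coord (j : 'I_n) : smoothr (fun x : 'rV[R]_n => x 0 j).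
Proof.
apply/smoothrP; split=> [x|i]; first exact: coord_continuous.
rewrite partial_coord; split; last exact: smoothr_cst.
by move=> x; have [] := is_derive_coord x (delta_mx 0 i) j.
Qed.

(** Iterated derivatives are indexed by words rather than multi-indices: inductions peel off one
    letter, and Leibniz' rule needs no binomial coefficients. Symmetry of second derivatives gives
    the translation to [mi_partial]. *)
Fixpoint dw w f := if w is i :: w' then dw w' (partial i f) else f.

Lemma dw_cat w v f : dw (w ++ v) f = dw v (dw w f).
Proof. by elim: w f => //= i w IH f. Qed.

Lemma smoothr_dw w f : smoothr f -> smoothr (dw w f).
Proof. by elim: w f => //= i w IH f sf; exact/IH/smoothr_partial. Qed.

Lemma dwD w f g : smoothr f -> smoothr g ->
  dw w (fun x => f x + g x) = (fun x => dw w f x + dw w g x).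
Proof.
elim: w f g => //= i w IH f g sf sg.
by rewrite partialD// IH//; exact: smoothr_partial.
Qed.

Lemma dwZ w c f : smoothr f -> dw w (fun x => c * f x) = (fun x => c * dw w f x).
Proof.
elim: w f => //= i w IH f sf.
by rewrite partialZ// IH//; exact: smoothr_partial.
Qed.

Lemma dw_cst w c x : `|dw w (fun _ => c) x| <= `|c|.
Proof.
elim: w c => //= i w IH c; rewrite partial_cst; apply: le_trans (IH 0) _.
by rewrite normr0.
Qed.

(** Leibniz' rule without its coefficients: each letter doubles the number of terms. The point [x]
    is fixed, so that [A] and [B] may later be powers of [weight x]. *)
Lemma dwM_le x (A B : R) l f g : smoothr f -> smoothr g ->
  0 <= A ->
  (forall v, (size v <= l)%N -> `|dw v f x| <= A) ->
  (forall v, (size v <= l)%N -> `|dw v g x| <= B) ->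
  forall w, (size w <= l)%N -> `|dw w (fun x => f x * g x) x| <= 2 ^+ l * (A * B).
Proof.
move=> sf sg A0 fA gB w wl.
have : `|dw w (fun x => f x * g x) x| <= 2 ^+ size w * (A * B).
  have B0 : 0 <= B := le_trans (normr_ge0 _) (gB [::] isT).
  elim: w l wl f g sf sg fA gB => [|i w IH] l wl f g sf sg fA gB /=.
    by rewrite expr0 mul1r normrM ler_pM// ?(fA [::])// ?(gB [::]).
  case: l wl fA gB => // l wl fA gB.
  rewrite partialM// dwD; [|exact/smoothrM/sg/smoothr_partial|
    exact/smoothrM/smoothr_partial].
  rewrite (le_trans (ler_normD _ _))// exprS -mulrA mulr2n mulrDl mul1r lerD//.
  - apply: (IH l) => //; first exact: smoothr_partial.
      by move=> v vl; apply: (fA (i :: v)).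
    by move=> v vl; apply: gB; exact: leqW.
  - apply: (IH l) => //; first exact: smoothr_partial.
      by move=> v vl; apply: fA; exact: leqW.
    by move=> v vl; apply: (gB (i :: v)).
move=> /le_trans; apply; rewrite ler_wpM2r// ?ler_weXn2l ?ler1n//.
by rewrite mulr_ge0// (le_trans (normr_ge0 _) (gB [::] isT)).
Qed.

(* The left-hand side is symmetric in u and v, which gives [derive_comm]. *)
Lemma second_difference f (u v x : 'rV[R]_n) (h : R) : 0 < h ->
  (forall y, derivable f y u) -> (forall y, derivable ('D_u f) y v) ->
  exists2 cd : R * R, 0 <= cd.1 <= h /\ 0 <= cd.2 <= h &
  f (x + h *: u + h *: v) - f (x + h *: u) - f (x + h *: v) + f x =
  h ^+ 2 * 'D_v ('D_u f) (x + cd.1 *: u + cd.2 *: v).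
Proof.
move=> h0 fu fuv.
have D1 (s : R) : is_derive s 1
   (fun s : R => f (x + h *: v + s *: u) - f (x + s *: u))
   ('D_u f (x + h *: v + s *: u) - 'D_u f (x + s *: u)).
  by apply: is_deriveB; exact: is_derive_line.
have [|c /= /itvP ci E1] := @MVT _ _
    (fun s => 'D_u f (x + h *: v + s *: u) - 'D_u f (x + s *: u))
    _ _ h0 (fun s _ => D1 s).
  by apply: derivable_within_continuous => s _; have [] := D1 s.
have D2 (s : R) : is_derive s 1 (fun s : R => 'D_u f (x + c *: u + s *: v))
    ('D_v ('D_u f) (x + c *: u + s *: v)) by exact: is_derive_line.
have [|d /= /itvP di E2] := @MVT _ _
    (fun s => 'D_v ('D_u f) (x + c *: u + s *: v)) _ _ h0 (fun s _ => D2 s).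
  by apply: derivable_within_continuous => s _; have [] := D2 s.
exists (c, d); first by rewrite /= !ltW ?ci ?di.
move: E1 E2; rewrite /= !scale0r !addr0 subr0 => E1 E2.
rewrite [_ + c *: u + h *: v]addrAC in E2.
rewrite expr2 -mulrA [h * 'D_v _ _]mulrC -E2 mulrC -E1.
by rewrite [x + h *: u + _]addrAC; ring.
Qed.

Lemma dist_half (A B C e : R) :
  `|A - C| <= e / 2 -> `|B - C| <= e / 2 -> `|A - B| <= e.
Proof.
move=> A1 A2; have -> : A - B = (A - C) - (B - C) by ring.
by rewrite (le_trans (ler_normB _ _))// [e]splitr lerD.
Qed.

(** Schwarz's theorem. For small h both mixed derivatives take the value of the second difference
    divided by h^2 at points close to x; continuity brings the equality to x. *)
Lemma derive_comm f (u v : 'rV[R]_n) :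
  (forall y, derivable f y u) -> (forall y, derivable f y v) ->
  (forall y, derivable ('D_u f) y v) -> (forall y, derivable ('D_v f) y u) ->
  continuous ('D_v ('D_u f)) -> continuous ('D_u ('D_v f)) ->
  'D_v ('D_u f) = 'D_u ('D_v f).
Proof.
move=> fu fv fuv fvu c1 c2; apply/funext => x.
apply/eqP; rewrite -subr_eq0 -normr_le0; apply/ler_addgt0Pr => e e0.
rewrite add0r.
have e20 : 0 < e / 2 by rewrite divr_gt0.
have := c1 x; move=> /cvgrPdist_le /(_ _ e20) /nbhs_normP[d1 /= d10 H1].
have := c2 x; move=> /cvgrPdist_le /(_ _ e20) /nbhs_normP[d2 /= d20 H2].
pose d := Num.min d1 d2.
have d0 : 0 < d by rewrite lt_min d10.
(* With this [K] and h = d / (2K), any displacement a u + b v with a, b in [0, h] has norm at most h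
   K = d/2. The summand 1 keeps [K] positive. *)
pose K := 1 + `|u| + `|v|.
have K0 : 0 < K by rewrite /K -addrA ltr_pwDl// addr_ge0.
pose h := d / 2 / K.
have h0 : 0 < h by rewrite !divr_gt0.
have near_pt (a b : R) : 0 <= a <= h -> 0 <= b <= h ->
    `|x - (x + a *: u + b *: v)| < d.
  move=> /andP[a0 ah] /andP[b0 bh].
  rewrite -addrA opprD addrA subrr add0r normrN.
  apply: le_lt_trans (ler_normD _ _) _; rewrite !normrZ !ger0_norm//.
  apply: (@le_lt_trans _ _ (h * K)).
    rewrite /K -addrA mulrDr mulr1 mulrDr ler_wpDl ?(ltW h0)// lerD//;
    by rewrite ler_wpM2r.
  by rewrite /h divfK ?gt_eqF// ltr_pdivrMr// ltr_pMr// ltr1n.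
have [[a b] /= [ah bh] E1] := second_difference x h0 fu fuv.
have [[a' b'] /= [ah' bh'] E2] := second_difference x h0 fv fvu.
have E : 'D_v ('D_u f) (x + a *: u + b *: v) = 'D_u ('D_v f) (x + a' *: v + b' *: u).
  apply: (@mulfI _ (h ^+ 2)); first by rewrite expf_neq0// gt_eqF.
  apply: etrans (esym E1) _; apply: etrans _ E2.
  rewrite (addrAC x (h *: u)); congr (_ + _); exact: addrAC.
have /andP[N1 _] : (`|x - (x + a *: u + b *: v)| < d1) &&
    (`|x - (x + a *: u + b *: v)| < d2) by rewrite -lt_min near_pt.
have A1 := H1 (x + a *: u + b *: v) N1.
have A2 := H2 (x + a' *: v + b' *: u).
rewrite [_ + b' *: u]addrAC in A2 E.
have /andP[_ N2] : (`|x - (x + b' *: u + a' *: v)| < d1) &&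
    (`|x - (x + b' *: u + a' *: v)| < d2) by rewrite -lt_min near_pt.
have {}A2 := A2 N2.
by rewrite -E in A2; exact: dist_half A1 A2.
Qed.

Lemma partialC f i j : smoothr f ->
  partial i (partial j f) = partial j (partial i f).
Proof.
move=> sf; apply: derive_comm => [y|y|y|y||].
- exact: smoothr_derivable.
- exact: smoothr_derivable.
- exact/smoothr_derivable/smoothr_partial.
- exact/smoothr_derivable/smoothr_partial.
- exact/smoothr_continuous/smoothr_partial/smoothr_partial.
- exact/smoothr_continuous/smoothr_partial/smoothr_partial.
Qed.

Lemma dw_partial w i f : smoothr f -> dw w (partial i f) = partial i (dw w f).
Proof.
elim: w f => //= j w IH f sf; rewrite partialC// IH//; exact: smoothr_partial.
Qed.

Lemma dw_rem w i f : smoothr f -> i \in w -> dw w f = dw (i :: rem i w) f.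
Proof.
elim: w f => [//|j w IH f sf]; rewrite inE [rem _ _]/= eq_sym.
have [->|ij /= iw] := eqVneq j i; first by move=> _; exact: erefl.
rewrite (IH _ (smoothr_partial j sf) iw)/=.
by rewrite (partialC _ _ sf).
Qed.

Lemma dw_perm w v f : smoothr f -> perm_eq w v -> dw w f = dw v f.
Proof.
elim: w v f => [v f _|i w IH v f sf wv]; first by rewrite perm_sym => /perm_nilP ->.
have iv : i \in v by rewrite -(perm_mem wv) mem_head.
rewrite (dw_rem sf iv)/=; apply: IH; first exact: smoothr_partial.
by rewrite -(perm_cons i) (perm_trans wv)// perm_to_rem.
Qed.

Definition word_of_mi (alpha : multi_index n) : seq 'I_n :=
  flatten [seq nseq (alpha i) i | i <- enum 'I_n].

Lemma mi_partialE (alpha : multi_index n) f : smoothr f ->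
  mi_partial alpha f = dw (word_of_mi alpha) f.
Proof.
move=> sf; rewrite /mi_partial /word_of_mi.
elim: (enum 'I_n) => //= i s ->.
rewrite [RHS](@dw_perm _ (flatten [seq nseq (alpha i) i | i <- s] ++ nseq (alpha i) i))//.
  rewrite dw_cat; have := smoothr_dw (flatten [seq nseq (alpha i) i | i <- s]) sf.
  set g := dw _ _; elim: (alpha i) => //= k IH sg.
  by rewrite IH// dw_partial.
by rewrite perm_catC.
Qed.

Definition mi_of_word w : multi_index n := [ffun i => count_mem i w].

Lemma mi_of_wordK w : perm_eq (word_of_mi (mi_of_word w)) w.
Proof.
apply/allP => i _ /=; rewrite /word_of_mi count_flatten -map_comp.
rewrite sumnE big_map big_enum /= (bigD1 i)//= ffunE count_nseq/= eqxx mul1n.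
rewrite big1 ?addn0// => j ji; rewrite count_nseq/=.
by rewrite (negbTE ji) mul0n.
Qed.

Lemma dw_mi_partial w f : smoothr f -> dw w f = mi_partial (mi_of_word w) f.
Proof.
move=> sf; rewrite mi_partialE//; apply: dw_perm => //.
by rewrite perm_sym mi_of_wordK.
Qed.

Lemma partial_scale (s : R) f i : (forall x, derivable f x (delta_mx 0 i)) ->
  (forall x, derivable (fun x => f (s *: x)) x (delta_mx 0 i)) /\
  partial i (fun x => f (s *: x)) = (fun x => s * partial i f (s *: x)).
Proof.
move=> df.
have D x : is_derive x (delta_mx 0 i : 'rV[R]_n) (fun x => f (s *: x)) (s * partial i f (s *: x)).
  have := (is_derive_lineP (fun x => f (s *: x)) x (delta_mx 0 i) 0 (s * partial i f (s *: x))).2.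
  rewrite scale0r addr0; apply.
  rewrite [X in is_derive _ _ X _](_ : _ =
    (fun r => f (s *: x + r *: delta_mx 0 i)) \o (fun h : R => h * s)); last first.
    by apply/funext => h /=; rewrite scalerDr scalerA [s * h]mulrC.
  have Dg : is_derive ((0 : R) * s) (1 : R) (fun r => f (s *: x + r *: delta_mx 0 i))
      (partial i f (s *: x)).
    have := @is_derive_line f (s *: x) (delta_mx 0 i) (0 * s) (df _).
    by rewrite {2}mul0r scale0r addr0.
  rewrite [s * partial _ _ _]mulrC.
  have Dh : is_derive (0 : R) (1 : R) (fun h : R => h * s) s.
    have := @is_deriveM _ _ id (cst s) (0 : R) (1 : R) _ _ (is_derive_id _ _) (is_derive_cst _ _ _).
    by move=> /is_derive_eq; apply; rewrite scaler0 add0r [_ *: _]mulr1.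
  exact: (@is_derive1_comp _ _ (fun h : R => h * s) 0 _ _ Dg Dh).
by split=> [x|]; [have [] := D x|apply/funext => x; have [_] := D x].
Qed.

Lemma smoothr_scale (s : R) f : smoothr f -> smoothr (fun x => f (s *: x)).
Proof.
move=> sf k; elim: k f sf => [|k IH] f sf /=.
  move=> x; apply: (@continuous_comp _ _ _ (fun x => s *: x) f).
    exact: scaler_continuous.
  exact: smoothr_continuous.
split=> [x|i].
  apply: (@continuous_comp _ _ _ (fun x => s *: x) f).
    exact: scaler_continuous.
  exact: smoothr_continuous.
have [d ->] := partial_scale s (fun x => smoothr_derivable x i sf).
split=> //; apply: of_class_CM; first exact: of_class_C_cst.
exact/IH/smoothr_partial.
Qed.

Lemma dw_scale w (s : R) f x : smoothr f ->
  dw w (fun x => f (s *: x)) x = s ^+ size w * dw w f (s *: x).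
Proof.
move=> sf; elim: w f sf => [|i w IH] f sf /=; first by rewrite mul1r.
have [_ ->] := partial_scale s (fun x => smoothr_derivable x i sf).
have sp := smoothr_partial i sf.
rewrite dwZ; last exact: smoothr_scale.
by rewrite IH// exprS mulrA.
Qed.

End words.

Arguments smoothr_derivable {R n f} x i _.

(** * Lebesgue measure and integrals on R^n *)

Section lebesgue_Rn_theory.
Variable R : realType.
Implicit Types n : nat.

Definition tbox n (ab : 'I_n -> R * R) : set (Rtuple R n) :=
  [set t | forall i, (ab i).1 < tnth t i < (ab i).2].

Lemma measurable_tbox n (ab : 'I_n -> R * R) : measurable (tbox ab).
Proof.
rewrite (_ : tbox ab =
  \bigcap_(i in [set: 'I_n]) ((@tnth n (measurableTypeR R))^~ i @^-1` `](ab i).1, (ab i).2[)).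
  apply: fin_bigcap_measurable => [|i _]; first exact: finite_finset.
  rewrite -[_ @^-1` _]setTI.
  exact: (@measurable_tnth _ (measurableTypeR R)).
apply/seteqP; split=> t ht i.
  by move=> _; rewrite /= in_itv/=; exact: ht.
by have := ht i I; rewrite /= in_itv/=.
Qed.

(** Bridges the topology of row vectors and the sigma-algebra of tuples: an open set is the union of
    the boxes with rational endpoints that it contains, and these are countably many. *)
Lemma measurable_rowt_open n (U : set 'rV[R]_n) : open U ->
  measurable (@rowt R n @^-1` U).
Proof.
move=> oU.
pose r (q : {ffun 'I_n -> rat * rat}) i : R * R := (ratr (q i).1, ratr (q i).2).
pose F (q : {ffun 'I_n -> rat * rat}) : set (Rtuple R n) :=
  if `[< forall t, tbox (r q) t -> U (rowt t) >] then tbox (r q) else set0.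
have -> : @rowt R n @^-1` U = \bigcup_q F q.
  apply/seteqP; split=> [t Ut|t [q _]]; last first.
    by rewrite /F; case: asboolP => // H /H.
  have /nbhs_ballP[e /= e0 eU] : nbhs (rowt t) U by exact: open_nbhs_nbhs.
  have /choice[q Hq] i : exists q : rat * rat,
      tnth t i - e < ratr q.1 < tnth t i /\ tnth t i < ratr q.2 < tnth t i + e.
    have [|a] := @rat_in_itvoo R (tnth t i - e) (tnth t i).
      by rewrite ltrBlDr ltrDl.
    have [|b] := @rat_in_itvoo R (tnth t i) (tnth t i + e).
      by rewrite ltrDl.
    by rewrite !in_itv/= => bt at_; exists (a, b).
  exists [ffun i => q i] => //; rewrite /F asboolT; last first.
    move=> s st; apply: eU; split=> // i j; rewrite !mxE.
    have := st j; rewrite /r ffunE /=.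
    have := Hq j; rewrite /ball /= ltr_norml => -[/andP[a1 a2] /andP[b1 b2]] /andP[c1 c2].
    by apply/andP; split; lra.
  by move=> i; rewrite /r ffunE/=; have [/andP[_ ->] /andP[-> _]] := Hq i.
apply: countable_bigcupT_measurable => [|q]; first exact: countableP.
by rewrite /F; case: ifP => // _; exact: measurable_tbox.
Qed.

Lemma continuous_measurable_rowt n (f : 'rV[R]_n -> R) : continuous f ->
  measurable_fun setT (fun t : Rtuple R n => f (rowt t)).
Proof.
move=> /continuousP cf; apply: (measurability _ (RGenOpens.measurableE R)).
move=> _ [_ [a [b ->] <-]]; rewrite setTI.
exact: (measurable_rowt_open (cf _ (interval_open _ _))).
Qed.

(** The row-vector counterpart of [consR], for inductions on the dimension. *)
Definition consv n (r : R) (y : 'rV[R]_n) : 'rV[R]_n.+1 :=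
  \row_i (if unlift ord0 i is Some j then y 0 j else r).

Lemma consv0 n r (y : 'rV[R]_n) : consv r y 0 ord0 = r.
Proof. by rewrite mxE unlift_none. Qed.

Lemma consvS n r (y : 'rV[R]_n) j : consv r y 0 (lift ord0 j) = y 0 j.
Proof. by rewrite mxE liftK. Qed.

Lemma rowt_consR n (p : measurableTypeR R * Rtuple R n) :
  rowt (consR p) = consv p.1 (rowt p.2).
Proof.
apply/rowP => i; rewrite !mxE; case: unliftP => [j ->|->].
  by rewrite tnthS mxE.
by rewrite /consR (tnth_nth 0).
Qed.

Lemma ball_consv n (r r' e : R) (y y' : 'rV[R]_n) :
  ball r e r' -> ball y e y' -> ball (consv r y) e (consv r' y').
Proof.
move=> rr' [e0 yy']; split=> // i j; rewrite (ord1 i).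
by case: (unliftP ord0 j) => [k ->|->]; rewrite ?consvS ?consv0.
Qed.

Lemma continuous_consvr n (r : R) : continuous (@consv n r).
Proof.
move=> y; apply: (@cvg_ballP _ _ _ _ (nbhs_filter y) (consv r) _).2 => e e0.
apply/nbhs_ballP; exists e => // z yz.
by apply: ball_consv => //; exact: ballxx.
Qed.

Lemma continuous_consvl n (y : 'rV[R]_n) : continuous (@consv n ^~ y).
Proof.
move=> r.
apply: (@cvg_ballP R 'rV[R]_n.+1 R (nbhs r) _ (fun r => consv r y) _).2 => e e0.
apply/nbhs_ballP; exists e => // z yz.
by apply: ball_consv => //; exact: ballxx.
Qed.

Lemma consv_line0 n (r h : R) (y : 'rV[R]_n) :
  consv (r + h) y = consv r y + h *: delta_mx 0 ord0.
Proof.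
apply/rowP => i; case: (unliftP ord0 i) => [k ->|->]; rewrite mxE mxE.
  by rewrite liftK consvS !mxE eqxx/= mulr0 addr0.
by rewrite unlift_none consv0 !mxE !eqxx/= mulr1.
Qed.

Lemma consv_lineS n (r h : R) (y : 'rV[R]_n) j :
  consv r (y + h *: delta_mx 0 j) = consv r y + h *: delta_mx 0 (lift ord0 j).
Proof.
apply/rowP => i; case: (unliftP ord0 i) => [k ->|->]; rewrite mxE mxE.
  by rewrite liftK consvS !mxE !eqxx/= ?(inj_eq lift_inj).
by rewrite unlift_none consv0 !mxE eqxx/= mulr0 addr0.
Qed.

(* A polynomial weight comparable with powers of the japanese bracket; being a
   product, it is compatible with Fubini. *)
Definition weight n (x : 'rV[R]_n) : R := \prod_i (1 + x 0 i ^+ 2).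

Lemma weight_ge1 n (x : 'rV[R]_n) : 1 <= weight x.
Proof.
rewrite /weight; elim/big_ind: _ => // [a b a1 b1|i _].
  by rewrite -[1]mulr1 ler_pM.
by rewrite lerDl sqr_ge0.
Qed.

Lemma weight_gt0 n (x : 'rV[R]_n) : 0 < weight x.
Proof. exact: lt_le_trans (weight_ge1 x). Qed.

Lemma weight_ge0 n (x : 'rV[R]_n) : 0 <= weight x.
Proof. exact/ltW/weight_gt0. Qed.

Lemma weightV_ge0 n (x : 'rV[R]_n) : 0 <= (weight x)^-1.
Proof. by rewrite invr_ge0 weight_ge0. Qed.

Lemma prod_weightX n (k : nat) (x : 'rV[R]_n) :
  \prod_(i <- flatten (nseq k (index_enum 'I_n))) (1 + x 0 i ^+ 2) = weight x ^+ k.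
Proof.
elim: k => [|k IH]; first by rewrite big_nil.
by rewrite /= big_cat IH exprS.
Qed.

Lemma weight_consv n r (y : 'rV[R]_n) : weight (consv r y) = (1 + r ^+ 2) * weight y.
Proof.
rewrite /weight big_ord_recl consv0; congr (_ * _).
by apply: eq_bigr => i _; rewrite consvS.
Qed.

Lemma smoothr_weight n : smoothr (@weight n).
Proof.
rewrite /weight; elim: (index_enum _) => [|i s IH].
  rewrite (_ : (fun x => _) = fun=> 1); first exact: smoothr_cst.
  by apply/funext => y; rewrite big_nil.
rewrite (_ : (fun x => _) = fun x : 'rV[R]_n =>
    (1 + x 0 i * x 0 i) * \prod_(i <- s) (1 + x 0 i ^+ 2)).
  apply: smoothrM IH; apply: smoothrD; first exact: smoothr_cst.
  by apply: smoothrM; exact: smoothr_coord.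
by apply/funext => y; rewrite big_cons expr2.
Qed.

Lemma continuous_weight n : continuous (@weight n).
Proof. exact/smoothr_continuous/smoothr_weight. Qed.

Lemma continuous_weightV n : continuous (fun x => (@weight n x)^-1).
Proof.
by move=> x; apply: continuousV; [rewrite gt_eqF// weight_gt0|exact: continuous_weight].
Qed.

Let leb : {sigma_finite_measure set (measurableTypeR R) -> \bar R} :=
  lebesgue_measure.

Lemma integrable_inv1Dsqr :
  leb.-integrable setT (fun r : R => ((1 + r ^+ 2)^-1)%:E).
Proof.
have c1 : continuous (fun r : R => (1 + r ^+ 2)^-1) := @continuous_oneDsqrV R.
apply/integrableP; split.
  by apply/measurable_EFinP; exact: continuous_measurable_fun.
under eq_integral => r _.
  rewrite gee0_abs; last by rewrite lee_fin invr_ge0 addr_ge0// sqr_ge0.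
  over.
rewrite [ltLHS](@ge0_symfun_integralT _ (fun r : R => (1 + r ^+ 2)^-1)).
- rewrite -set_itvcy integral0y_oneDsqr; exact: ltry.
- by move=> r; rewrite invr_ge0 addr_ge0// sqr_ge0.
- exact: c1.
- by move=> r; rewrite /= sqrrN.
Qed.

(** The integral of g' over a symmetric interval is the difference of the end values of g, which
    tends to 0; dominated convergence identifies the limit of these integrals with the integral over
    the line. *)
Lemma integral_derive1_0 (g : R -> R) (C : R) :
  (forall x, derivable g x 1) -> continuous ('D_1 g) ->
  (forall x, `|g x| <= C / (1 + x ^+ 2)) ->
  (forall x, `|'D_1 g x| <= C / (1 + x ^+ 2)) ->
  (\int[leb]_x ('D_1 g x)%:E = 0)%E.
Proof.
move=> dg cdg gC dgC.
have cg : continuous g.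
  by move=> x; apply: differentiable_continuous; apply/derivable1_diffP.
(* The shift to [k.+1] keeps the interval nondegenerate at k = 0, as the fundamental theorem of
   calculus requires. *)
pose D k : set R := `[- k.+1%:R, k.+1%:R]%classic.
pose f_ k : R -> \bar R := (EFin \o 'D_1 g) \_ (D k).
have mdg : measurable_fun setT (EFin \o 'D_1 g).
  by apply/measurable_EFinP; exact: continuous_measurable_fun.
have mf_ k : measurable_fun setT (f_ k).
  apply/(measurable_restrictT _ _).1; first exact: measurable_itv.
  exact: measurable_funTS.
have C0 : 0 <= C by have := le_trans (normr_ge0 _) (gC 0); rewrite expr0n/= addr0 divr1.
have ig : leb.-integrable setT (fun r : R => (C * (1 + r ^+ 2)^-1)%:E).
  by under eq_fun do rewrite EFinM; exact/integrableZl/integrable_inv1Dsqr.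
have f_f : {ae leb, forall x, setT x -> f_ ^~ x @ \oo --> (EFin \o 'D_1 g) x}.
  apply: aeW => x _; apply: (@cvg_near_cst _ _ _ _ _ _).
  near=> k; rewrite /f_ patchE ifT// inE /D /= in_itv/= -ler_norml.
  apply: le_trans (_ : k%:R <= _); last by rewrite ler_nat.
  by near: k; exact: nbhs_infty_ger.
have f_g : {ae leb, forall x k, setT x -> (`|f_ k x| <= (C * (1 + x ^+ 2)^-1)%:E)%E}.
  apply: aeW => x k _; rewrite /f_ patchE; case: ifP => _.
    by rewrite lee_fin.
  by rewrite abse0 lee_fin mulr_ge0// invr_ge0 addr_ge0// sqr_ge0.
have [_ _] := @dominated_convergence _ (measurableTypeR R) R leb setT measurableT
  f_ (EFin \o 'D_1 g) _ mf_ mdg f_f ig f_g.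
have -> : (fun k => \int[leb]_(x in setT) f_ k x)%E =
    (fun k : nat => (g k.+1%:R - g (- k.+1%:R))%:E).
  apply/funext => k; rewrite /f_ -integral_mkcond.
  have kk : - k.+1%:R < k.+1%:R :> R by rewrite gtrN.
  rewrite (@continuous_FTC2 _ _ g)//.
  - exact: continuous_subspaceT.
  - split=> //.
    + by apply: cvg_at_right_filter; exact: cg.
    + by apply: cvg_at_left_filter; exact: cg.
  - by move=> x _; rewrite derive1E.
move=> /cvg_unique; apply => //.
apply: cvg_EFin; first exact: nearW.
rewrite /comp/=.
apply/cvgrPdist_le => e e0; near=> k.
rewrite sub0r normrN (le_trans (ler_normB _ _))//.
have H (s : R) : s ^+ 2 = k.+1%:R ^+ 2 -> `|g s| <= e / 2.
  move=> sk; rewrite (le_trans (gC _))// sk.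
  rewrite ler_pdivrMr; last by rewrite ltr_pwDl// sqr_ge0.
  have : C / (e / 2) <= k%:R by near: k; exact: nbhs_infty_ger.
  rewrite ler_pdivrMr ?divr_gt0// mulrC => /le_trans; apply.
  apply: ler_wpM2l; first by rewrite ltW// divr_gt0.
  rewrite -natrX -[1]/(1%:R) -natrD ler_nat add1n ltnW// ltnS.
  by rewrite (leq_trans (leqnSn k))// -{1}(expn1 k.+1) leq_pexp2l.
by rewrite [e]splitr lerD// H// sqrrN.
Unshelve. all: by end_near. Qed.

End lebesgue_Rn_theory.

Section lebesgue_Rn_integral.
Variable R : realType.
Implicit Types n : nat.

Let leb : {sigma_finite_measure set (measurableTypeR R) -> \bar R} :=
  lebesgue_measure.

Local Notation lebn n := (lebesgue_Rn R n).

Lemma measurable_EFin_rowt n (f : 'rV[R]_n -> R) : continuous f ->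
  measurable_fun setT (fun t => (f (rowt t))%:E).
Proof. by move=> cf; apply/measurable_EFinP; exact: (continuous_measurable_rowt cf). Qed.

Lemma measurable_weightV n :
  measurable_fun setT (fun t => ((@weight R n (rowt t))^-1)%:E).
Proof. exact: (measurable_EFin_rowt (@continuous_weightV R n)). Qed.

Lemma integrable_prod_weightV n :
  (lebn n).-integrable setT (fun t => ((weight (rowt t))^-1)%:E) ->
  (leb \x lebn n)%E.-integrable setT
    ((fun t => ((weight (rowt t))^-1)%:E) \o @consR R n).
Proof.
move=> iw.
have mw : measurable_fun setT ((fun t => ((weight (rowt t))^-1)%:E) \o @consR R n).
  apply: measurableT_comp; last exact: measurable_consR.
  exact: measurable_weightV.
apply/(integrable12ltyP _ _ mw).
pose c := (\int[lebn n]_t ((weight (rowt t))^-1)%:E)%E.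
rewrite (_ : (fun x => _) = fun r : measurableTypeR R => (c * ((1 + r ^+ 2)^-1)%:E)%E).
  have := integrable_inv1Dsqr R => /(integrableZl measurableT) H.
  have cfin : c \is a fin_num by exact: integrable_fin_num.
  have := H (fine c); rewrite -/leb => /(integrable_lty measurableT).
  by under eq_integral do rewrite fineK//.
apply/funext => r; rewrite /c muleC -integralZl//.
apply: eq_integral => t _; rewrite /= rowt_consR weight_consv/= invfM -EFinM ger0_norm//.
by rewrite mulr_ge0// invr_ge0 ?addr_ge0 ?sqr_ge0// ltW// weight_gt0.
Qed.

Lemma integrable_weightV n :
  (lebn n).-integrable setT (fun t => ((weight (rowt t))^-1)%:E).
Proof.
elim: n => [|n IH].
  apply/integrableP; split.
    exact: measurable_weightV.
  rewrite /= integral_dirac//; last first.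
    exact: (measurableT_comp (@abse_measurable R setT) (@measurable_weightV 0)).
  by rewrite diracT mul1e ltry.
apply: integrable_pushforward => //.
- exact: measurable_consR.
- exact: measurable_weightV.
- by rewrite preimage_setT; exact: integrable_prod_weightV.
Qed.

Section weight_bound.
Variables (n : nat) (f : 'rV[R]_n -> R) (C : R).
Hypotheses (cf : continuous f) (fC : forall x, `|f x| <= C / weight x).

Lemma integrable_rowt : (lebn n).-integrable setT (fun t => (f (rowt t))%:E).
Proof.
apply: (@le_integrable _ _ _ _ _ measurableT _ (fun t => (C * (weight (rowt t))^-1)%:E)).
- exact: measurable_EFin_rowt.
- by move=> t _; rewrite /= lee_fin (le_trans (fC _))// ler_norm.
- by under eq_fun do rewrite EFinM; exact/integrableZl/integrable_weightV.
Qed.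

Definition weight_int : R := \int[lebn n]_t (weight (rowt t))^-1.

Lemma normr_Rintegral_rowt_le : `|\int[lebn n]_t f (rowt t)| <= C * weight_int.
Proof.
rewrite (le_trans (le_normr_Rintegral _ _))//; first exact: integrable_rowt.
rewrite /weight_int -RintegralZl//; last exact: integrable_weightV.
apply: le_Rintegral => //.
- by apply: integrable_norm; exact: integrable_rowt.
- rewrite (_ : _ \o _ = fun t => (C%:E * ((weight (rowt t))^-1)%:E)%E)//.
  exact/integrableZl/integrable_weightV.
Qed.
End weight_bound.

Section fubini_consR.
Variables (n : nat) (f : 'rV[R]_n.+1 -> R) (C : R).
Hypotheses (cf : continuous f) (fC : forall x, `|f x| <= C / weight x).

Let prod_integrable :
  (leb \x lebn n)%E.-integrable setT ((fun t => (f (rowt t))%:E) \o @consR R n).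
Proof.
apply: (@le_integrable _ _ _ _ _ measurableT _
    ((fun t => (C * (weight (rowt t))^-1)%:E) \o @consR R n)).
- apply: measurableT_comp; last exact: measurable_consR.
  exact: measurable_EFin_rowt.
- by move=> t _; rewrite /= lee_fin (le_trans (fC _))// ler_norm.
- rewrite (_ : _ \o _ = fun p => (C%:E *
    ((fun t => ((weight (rowt t))^-1)%:E) \o @consR R n) p)%E)//.
  exact/integrableZl/integrable_prod_weightV/integrable_weightV.
Qed.

Lemma integral_consR12 : (\int[lebn n.+1]_t (f (rowt t))%:E =
  \int[leb]_r \int[lebn n]_t (f (consv r (rowt t)))%:E)%E.
Proof.
transitivity (\int[(leb \x lebn n)%E]_p (f (rowt (consR p)))%:E)%E.
  rewrite [LHS](@integral_pushforward _ _ _ _ _ _ (@measurable_consR R n)).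
  - by rewrite preimage_setT.
  - exact: measurable_EFin_rowt.
  - by rewrite preimage_setT; exact: prod_integrable.
  - by [].
apply: etrans (esym (integral12_prod_meas1 prod_integrable)) _.
apply: eq_integral => r _; apply: eq_integral => t _.
by rewrite /= rowt_consR.
Qed.

(** Both orders of integration serve [integral_partial]: this one puts the first coordinate
    innermost, for a derivative along it; [integral_consR12] handles the other coordinates by
    induction. *)
Lemma integral_consR21 : (\int[lebn n.+1]_t (f (rowt t))%:E =
  \int[lebn n]_t \int[leb]_r (f (consv r (rowt t)))%:E)%E.
Proof.
rewrite integral_consR12; apply: etrans (etrans _ (Fubini prod_integrable)) _.
  by apply: eq_integral => r _; apply: eq_integral => t _; rewrite /= rowt_consR.
by apply: eq_integral => t _; apply: eq_integral => r _; rewrite /= rowt_consR.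
Qed.
End fubini_consR.

Lemma is_derive_consv0 n (f : 'rV[R]_n.+1 -> R) (r : R) (y : 'rV[R]_n) d :
  is_derive (consv r y) (delta_mx 0 ord0) f d ->
  is_derive r 1 (fun r => f (consv r y)) d.
Proof.
rewrite -[r in consv r y]add0r consv_line0 => /is_derive_lineP.
by under eq_fun do rewrite -consv_line0 add0r.
Qed.

Lemma is_derive_consvS n (f : 'rV[R]_n.+1 -> R) (r : R) (y : 'rV[R]_n) j d :
  is_derive (consv r y) (delta_mx 0 (lift ord0 j)) f d ->
  is_derive y (delta_mx 0 j) (fun y => f (consv r y)) d.
Proof.
move=> H; have := (is_derive_lineP (fun y => f (consv r y)) y (delta_mx 0 j) 0 d).2.
rewrite scale0r addr0; apply.
have := (is_derive_lineP f (consv r y) (delta_mx 0 (lift ord0 j)) 0 d).1.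
rewrite scale0r addr0 => /(_ H).
by under eq_fun do rewrite -consv_lineS.
Qed.

(* Fundamental theorem of calculus along the i-th axis, and Fubini. *)
Lemma integral_partial n (f : 'rV[R]_n -> R) (C : R) (i : 'I_n) :
  (forall x, derivable f x (delta_mx 0 i)) ->
  continuous f -> continuous (partial i f) ->
  (forall x, `|f x| <= C / weight x) ->
  (forall x, `|partial i f x| <= C / weight x) ->
  (\int[lebn n]_t (partial i f (rowt t))%:E = 0)%E.
Proof.
elim: n f C i => [f C []//|n IH] f C i df cf cpf fC pfC.
have [j ij|i0] := unliftP ord0 i; subst i.
  rewrite (integral_consR12 cpf pfC) integral0_eq// => r _.
  have H y : is_derive y (delta_mx 0 j) (fun y => f (consv r y))
      (partial (lift ord0 j) f (consv r y)).
    by apply: is_derive_consvS; exact/derivableP.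
  have E : partial j (fun y => f (consv r y)) =
      (fun y => partial (lift ord0 j) f (consv r y)).
    by apply/funext => y; have [_] := H y.
  transitivity (\int[lebn n]_t (partial j (fun y => f (consv r y)) (rowt t))%:E)%E.
    by rewrite E.
  apply: (IH _ (C / (1 + r ^+ 2))) => [y|y|y|y|y].
  - by have [] := H y.
  - exact: (continuous_comp (@continuous_consvr _ _ r y) (cf _)).
  - by rewrite E; exact: (continuous_comp (@continuous_consvr _ _ r y) (cpf _)).
  - by rewrite (le_trans (fC _))// weight_consv invfM mulrA.
  - by rewrite E (le_trans (pfC _))// weight_consv invfM mulrA.
rewrite (integral_consR21 cpf pfC) integral0_eq// => t _; set y := rowt t.
have H (r : R) : is_derive r 1 (fun r : R => f (consv r y)) (partial ord0 f (consv r y)).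
  by apply: is_derive_consv0; exact/derivableP.
have E : 'D_1 (fun r : R => f (consv r y)) = (fun r => partial ord0 f (consv r y)).
  by apply/funext => r; have [_] := H r.
transitivity (\int[leb]_r ('D_1 (fun r : R => f (consv r y)) r)%:E)%E.
  apply: eq_integral => r _; have [_ e] := H r.
  exact: (congr1 (@EFin R) (esym e)).
apply: (@integral_derive1_0 _ _ (C / weight y)) => [r|r|r|r].
- by have [] := H r.
- by rewrite E; exact: (continuous_comp (@continuous_consvl _ _ y r) (cpf _)).
- by rewrite (le_trans (fC _))// weight_consv invfM mulrAC mulrA.
- rewrite (_ : 'D_1 _ r = partial ord0 f (consv r y)); last by have [] := H r.
  by rewrite (le_trans (pfC _))// weight_consv invfM mulrAC mulrA.
Qed.

End lebesgue_Rn_integral.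

(** * Continuity and differentiability of integrals depending on a parameter *)

Section parameter_integral.
Variables (R : realType) (p n : nat).
Local Notation lebn := (lebesgue_Rn R n).
Variable F : 'rV[R]_p -> 'rV[R]_n -> R.

(** Domination is asked only on the unit ball around x, because the kernels to come are bounded by
    quantities that grow with x. Dominated convergence concerns sequences, hence the argument by
    contradiction: a sequence tending to x along which the integrals stay [e] apart from the value
    at x cannot exist. *)
Lemma continuous_param_integral (C : R) (x : 'rV[R]_p) :
  (forall x, continuous (F x)) ->
  (forall y, {for x, continuous (F ^~ y)}) ->
  (forall x' y, `|x' - x| <= 1 -> `|F x' y| <= C / weight y) ->
  {for x, continuous (fun x => \int[lebn]_t F x (rowt t))}.
Proof.
move=> cF cFx FC.
suff H : forall e : R, 0 < e -> exists2 d : R, 0 < d & forall x' : 'rV[R]_p, `|x - x'| < d ->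
    `|\int[lebn]_t F x (rowt t) - \int[lebn]_t F x' (rowt t)| < e.
  apply: (@cvgrPdist_lt _ _ _ (nbhs x) _ (fun x => \int[lebn]_t F x (rowt t)) _).2 => e e0.
  have [d d0 Hd] := H _ e0.
  by apply: (@nbhs_normP R 'rV[R]_p x _).2; exists d => // x' /Hd.
apply: contrapT => /existsNP[e /not_implyP[e0 /forall2NP He]].
have /choice[u Hu] (k : nat) : exists x' : 'rV[R]_p, `|x - x'| < k.+1%:R^-1 /\
    e <= `|\int[lebn]_t F x (rowt t) - \int[lebn]_t F x' (rowt t)|.
  have [|/existsNP[x' /not_implyP[h1 /negP h2]]] := He k.+1%:R^-1.
    by rewrite invr_gt0 ltr0n.
  by exists x'; rewrite leNgt.
have u1 k : `|u k - x| <= 1.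
  rewrite distrC ltW// (lt_le_trans (Hu k).1)// invf_le1 ?ltr0n//.
  by rewrite ler1n.
have u_cvg : u @ \oo --> x.
  apply/cvgrPdist_lt => d d0; near=> k; apply: lt_trans (Hu k).1 _.
  by near: k; exact: near_infty_natSinv_lt (PosNum d0).
have f_f : {ae lebn, forall t, setT t ->
    (fun k => (F (u k) (rowt t))%:E) @ \oo --> (F x (rowt t))%:E}.
  apply: aeW => t _; apply: cvg_EFin; first exact: nearW.
  exact: (cvg_comp _ _ u_cvg (cFx (rowt t))).
have ig : lebn.-integrable setT (fun t => (C * (weight (rowt t))^-1)%:E).
  by under eq_fun do rewrite EFinM; exact/integrableZl/integrable_weightV.
have f_g : {ae lebn, forall t k, setT t ->
    (`|(F (u k) (rowt t))%:E| <= (C * (weight (rowt t))^-1)%:E)%E}.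
  by apply: aeW => t k _; rewrite lee_fin FC.
have [iF _ +] := @dominated_convergence _ _ _ lebn setT measurableT
  (fun k t => (F (u k) (rowt t))%:E) (fun t => (F x (rowt t))%:E) _
  (fun k => measurable_EFin_rowt (cF (u k))) (measurable_EFin_rowt (cF x))
  f_f ig f_g.
rewrite -[X in _ --> X]fineK; last exact: integrable_fin_num.
move=> /fine_cvg /cvgrPdist_lt /(_ _ e0)[k _ /(_ k (leqnn k))]/=.
by rewrite ltNge; case: (Hu k) => _ ->.
Unshelve. all: by end_near. Qed.

Lemma is_derive_param_integral (C : R) (x : 'rV[R]_p) (i : 'I_p) :
  (forall x, continuous (F x)) ->
  (forall x y, derivable (F ^~ y) x (delta_mx 0 i)) ->
  (forall x' y, `|x' - x| <= 1 -> `|F x' y| <= C / weight y) ->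
  (forall x' y, `|x' - x| <= 1 -> `|partial i (F ^~ y) x'| <= C / weight y) ->
  is_derive x (delta_mx 0 i : 'rV[R]_p) (fun x => \int[lebn]_t F x (rowt t))
    (\int[lebn]_t partial i (F ^~ (rowt t)) x).
Proof.
move=> cF dF FC dFC.
(* Restriction to the line through x along the i-th axis turns this into a one-variable statement.
   The parameter ranges over ]-1, 1[: the axis vector has sup norm at most 1, so the points stay
   where domination holds. *)
pose f (s : R) (t : Rtuple R n) := F (x + s *: delta_mx 0 i) (rowt t).
have Df (s : R) (t : Rtuple R n) : is_derive s (1 : R) (f ^~ t)
    (partial i (F ^~ (rowt t)) (x + s *: delta_mx 0 i)).
  apply: (is_derive_lineP (F ^~ (rowt t)) x (delta_mx 0 i) s _).1.
  exact/derivableP/dF.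
have C0 : 0 <= C.
  have := le_trans (normr_ge0 _) (FC x 0 _); rewrite subrr normr0 => /(_ ler01).
  by rewrite pmulr_lge0// invr_gt0 weight_gt0.
have near_x (s : R) : `]-1, 1[%classic s -> `|x + s *: delta_mx 0 i - x| <= 1.
  rewrite /= in_itv/= => /andP[s1 s2]; rewrite addrC addKr normrZ.
  rewrite -[leRHS]mulr1 ler_pM//; first by rewrite ler_norml !ltW.
  rewrite [leLHS]/Num.Def.normr /= mx_normrE; apply/bigmax_leP; split=> // -[j k] _ /=.
  by rewrite !mxE; case: (_ && _); rewrite /= ?normr1 ?normr0.
have I0 : `]-1, 1[%classic (0 : R) by rewrite /= in_itv/= ltrN10 ltr01.
have intf s : `]-1, 1[%classic s -> lebn.-integrable setT (EFin \o f s).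
  move=> s1; apply: (@le_integrable _ _ _ _ _ measurableT _
      (fun t => (C * (weight (rowt t))^-1)%:E)).
  - exact: (measurable_EFin_rowt (cF _)).
  - move=> t _; rewrite /= lee_fin.
    exact: (le_trans (FC _ _ (near_x _ s1)) (ler_norm _)).
  - by under eq_fun do rewrite EFinM; exact/integrableZl/integrable_weightV.
have derf1 s t : `]-1, 1[%classic s -> [set: Rtuple R n] t -> derivable (f ^~ t) s 1.
  by move=> _ _; have [] := Df s t.
have G0 (t : Rtuple R n) : 0 <= C * (weight (rowt t))^-1.
  by rewrite mulr_ge0// invr_ge0 ltW// weight_gt0.
have iG : lebn.-integrable setT (EFin \o (fun t => C * (weight (rowt t))^-1)).
  rewrite (_ : _ \o _ = fun t => (C%:E * ((weight (rowt t))^-1)%:E)%E)//.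
  exact/integrableZl/integrable_weightV.
have pE s t : partial1of2 f s t = partial i (F ^~ (rowt t)) (x + s *: delta_mx 0 i).
  by rewrite partial1of2E; have [_] := Df s t.
have Gub s t : `]-1, 1[%classic s -> [set: Rtuple R n] t ->
    `|partial1of2 f s t| <= C * (weight (rowt t))^-1.
  by move=> s1 _; rewrite pE; exact: dFC (near_x _ s1).
have D1 := @derivable_under_integral _ _ _ lebn f setT measurableT 0 _ _
  I0 intf derf1 _ G0 iG Gub.
have D2 := @differentiation_under_integral _ _ _ lebn f setT measurableT 0 _ _
  I0 intf derf1 _ G0 iG Gub.
have := (is_derive_lineP (fun x => \int[lebn]_t F x (rowt t)) x (delta_mx 0 i) 0
  (\int[lebn]_t partial i (F ^~ (rowt t)) x)).2.
rewrite scale0r addr0; apply; apply: DeriveDef; first exact: D1.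
rewrite -derive1E [LHS]D2; apply: eq_Rintegral => t _.
by rewrite pE scale0r addr0.
Qed.

End parameter_integral.

(** * Essential suprema and pointwise bounds *)

Section Linfty.
Variable R : realType.
Implicit Types n : nat.

Lemma lebesgue_Rn_box_gt0 n (x : 'rV[R]_n) (e : R) : 0 < e ->
  (0 < lebesgue_Rn R n (tbox (fun i => (x 0 i - e, x 0 i + e)%R)))%E.
Proof.
move=> e0; elim: n x => [|n IH] x.
  have -> : tbox (fun i : 'I_0 => (x 0 i - e, x 0 i + e)) = setT.
    by apply/seteqP; split=> // t _ [].
  by rewrite /= diracT lte01.
rewrite /= /lebesgue_succ /pushforward.
pose y := \row_j x 0 (lift ord0 j).
rewrite (_ : _ @^-1` _ = `]x 0 ord0 - e, x 0 ord0 + e[%classic `*`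
    tbox (fun i => (y 0 i - e, y 0 i + e))); last first.
  apply/seteqP; split=> [[r t] h|[r t] [/= rx tx]] /=.
    split=> /=; first by have := h ord0; rewrite in_itv.
    by move=> j; have := h (lift ord0 j); rewrite tnthS mxE.
  move=> i; case: (unliftP ord0 i) => [j ->|->]; last by move: rx; rewrite in_itv.
  by have := tx j; rewrite tnthS mxE.
rewrite product_measure1E//; last exact: measurable_tbox.
rewrite mule_gt0//= lebesgue_measure_itv/= lte_fin.
have h : x 0 ord0 - e < x 0 ord0 + e by rewrite ltrD2l gtrN.
by rewrite h lte_fin subr_gt0.
Qed.

Lemma open_lebesgue_Rn_gt0 n (U : set 'rV[R]_n) : open U -> U !=set0 ->
  (0 < lebesgue_Rn R n (@rowt R n @^-1` U))%E.
Proof.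
move=> oU [x Ux].
have /nbhs_ballP[e /= e0 eU] : nbhs x U by exact: open_nbhs_nbhs.
apply: lt_le_trans (lebesgue_Rn_box_gt0 x e0) _.
apply: le_measure; rewrite ?inE.
- exact: measurable_tbox.
- exact: measurable_rowt_open.
move=> t ht; apply: eU; split=> // i j; rewrite (ord1 i) mxE.
have := ht j; rewrite /ball /= ltr_norml => /andP[h1 h2].
by apply/andP; split; lra.
Qed.

Lemma lebesgue_RnT_gt0 n : (0 < lebesgue_Rn R n setT)%E.
Proof.
have := @open_lebesgue_Rn_gt0 n setT openT; rewrite preimage_setT; apply.
by exists 0.
Qed.

Lemma normc_sqrt (z : R[i]) :
  Normc.normc z = Num.sqrt (complex.Re z ^+ 2 + complex.Im z ^+ 2).
Proof. by case: z. Qed.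

Lemma normc_nonneg (z : R[i]) : 0 <= Normc.normc z.
Proof. by rewrite normc_sqrt sqrtr_ge0. Qed.

Lemma Re_le_normc (z : R[i]) : `|complex.Re z| <= Normc.normc z.
Proof. by rewrite normc_sqrt -sqrtr_sqr ler_wsqrtr// lerDl sqr_ge0. Qed.

Lemma Im_le_normc (z : R[i]) : `|complex.Im z| <= Normc.normc z.
Proof. by rewrite normc_sqrt -sqrtr_sqr ler_wsqrtr// lerDr sqr_ge0. Qed.

Lemma Linfty_norm_le n (f : 'rV[R]_n -> R[i]) (M : R) :
  (forall x, Normc.normc (f x) <= M) -> (Linfty_norm f <= M%:E)%E.
Proof.
(* The norm with exponent +oo is an essential supremum only when the whole space has positive
   measure, so that branch has to be selected. *)
move=> fM; rewrite /Linfty_norm unlock /= lebesgue_RnT_gt0.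
apply/ess_supP; apply: aeW => t /=.
by rewrite lee_fin ger0_norm// normc_nonneg.
Qed.

(** Otherwise some real M lies between the norm and the value at x; the set where the modulus
    exceeds M is open and nonempty, hence of positive measure, yet negligible by definition of the
    essential supremum. *)
Lemma le_Linfty_norm n (f : 'rV[R]_n -> R[i]) x :
  continuous (fun x => Normc.normc (f x)) ->
  ((Normc.normc (f x))%:E <= Linfty_norm f)%E.
Proof.
move=> cf; rewrite leNgt; apply/negP => H.
pose g x := Normc.normc (f x).
have [M Mlt HM] : exists2 M : R, M < g x & (Linfty_norm f <= M%:E)%E.
  move: H; case: (Linfty_norm f) => [r|//|_]; first by rewrite lte_fin; exists r.
  by exists (g x - 1); rewrite ?ltrBlDr ?ltrDl// leNye.
have oU : open [set y | M < g y] by exact: (open_comp (fun y _ => cf y) (@open_gt R M)).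
have := open_lebesgue_Rn_gt0 oU (ex_intro _ x Mlt).
rewrite lt_neqAle => /andP[/eqP + _]; apply; apply/esym.
have := HM; rewrite /Linfty_norm unlock /= lebesgue_RnT_gt0 => /ess_supP.
move=> [N [mN N0 NM]]; apply: (subset_measure0 _ mN _ N0).
  exact: measurable_rowt_open.
move=> t /= Mt; apply: NM => /=; rewrite lee_fin ger0_norm ?normc_nonneg//.
by apply/negP; rewrite -ltNge.
Qed.

End Linfty.

(** * Oscillatory integrals *)

Section seminorms.
Variable R : realType.

Section decay.
Variable n : nat.
Implicit Types (h : 'rV[R]_n -> R) (w : seq 'I_n).

(** A Schwartz seminorm bound. The orders [k] (decay) and [l] (derivatives) stay separate, since the
    proof depends on which of the two each operation consumes; [rapid] below is membership in the
    real Schwartz space. *)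
Definition decay (k l : nat) (K : R) h := forall w, (size w <= l)%N ->
  forall x, weight x ^+ k * `|dw w h x| <= K.

Definition rapid h := smoothr h /\ forall k l, exists K, decay k l K h.

Lemma decay_ge0 k l K h : decay k l K h -> 0 <= K.
Proof.
move=> H; apply: le_trans (H [::] isT 0).
by rewrite mulr_ge0// exprn_ge0// ltW// weight_gt0.
Qed.

Lemma decayW k l K k' l' K' h : (k' <= k)%N -> (l' <= l)%N -> K <= K' ->
  decay k l K h -> decay k' l' K' h.
Proof.
move=> kk ll KK H w wl x; apply: le_trans KK; apply: le_trans (H w (leq_trans wl ll) x).
by rewrite ler_wpM2r// ler_weXn2l// weight_ge1.
Qed.

Lemma decay_partial k l K h i : decay k l.+1 K h -> decay k l K (partial i h).
Proof. by move=> H w wl x; apply: (H (i :: w)). Qed.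

Lemma abs_coord_le_weight (x : 'rV[R]_n) i : `|x 0 i| <= weight x.
Proof.
rewrite /weight (bigD1 i)//=.
apply: (@le_trans _ _ (1 + x 0 i ^+ 2)).
  rewrite -[x 0 i ^+ 2]real_normK ?num_real//.
  by have := sqr_ge0 (`|x 0 i| - 2^-1); nra.
rewrite ler_pMr; last by rewrite ltr_pwDl// sqr_ge0.
elim/big_ind: _ => // [a b a1 b1|j _].
  by rewrite -[1]mulr1 ler_pM.
by rewrite lerDl sqr_ge0.
Qed.

Lemma dw_coord_le w i (x : 'rV[R]_n) : `|dw w (fun x => x 0 i) x| <= weight x.
Proof.
case: w => [|j w] /=; first exact: abs_coord_le_weight.
rewrite partial_coord (le_trans (dw_cst _ _ _))//.
by case: (_ == _); rewrite ?normr1 ?normr0 ?weight_ge1// ltW// weight_gt0.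
Qed.

(** [dwM_le] at each point, with bounds A weight^k' and K / weight^(k+k'): a factor of polynomial
    growth consumes [k'] orders of decay and no derivative. *)
Lemma decayM k k' l K A h g : smoothr g -> smoothr h -> 0 <= A ->
  (forall w x, (size w <= l)%N -> `|dw w g x| <= A * weight x ^+ k') ->
  decay (k + k') l K h -> decay k l (2 ^+ l * (A * K)) (fun x => g x * h x).
Proof.
move=> sg sh A0 gA hK w wl x.
have w0 := weight_gt0 x.
have H := @dwM_le R n x (A * weight x ^+ k') (K / weight x ^+ (k + k')) l g h sg sh
  (mulr_ge0 A0 (exprn_ge0 _ (ltW w0))) (fun v vl => gA v x vl).
rewrite mulrC -ler_pdivlMr ?exprn_gt0//.
apply: le_trans (H _ w wl) _.
  by move=> v vl; rewrite ler_pdivlMr ?exprn_gt0// mulrC; exact: hK.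
have := gt_eqF (exprn_gt0 k w0); have := gt_eqF (exprn_gt0 k' w0).
rewrite exprD; move: (weight x ^+ k) (weight x ^+ k') => u v v0 u0.
rewrite (_ : A * v * (K / (u * v)) = A * K / u) ?mulrA//.
by field; rewrite u0 v0.
Qed.

Lemma decay_coord k l K h i : smoothr h -> decay k.+1 l K h ->
  decay k l (2 ^+ l * K) (fun x => x 0 i * h x).
Proof.
move=> sh; rewrite -addn1 => H.
have := @decayM k 1 l K 1 h (fun x => x 0 i) (smoothr_coord R i) sh ler01 _ H.
rewrite mul1r; apply=> w x _; rewrite mul1r expr1; exact: dw_coord_le.
Qed.

Lemma rapid_partial h i : rapid h -> rapid (partial i h).
Proof.
move=> [sh Hh]; split=> [|k l]; first exact: smoothr_partial.
by have [K HK] := Hh k l.+1; exists K; exact: decay_partial.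
Qed.

Lemma rapid_coord h i : rapid h -> rapid (fun x => x 0 i * h x).
Proof.
move=> [sh Hh]; split=> [|k l]; first by apply: smoothrM => //; exact: smoothr_coord.
by have [K HK] := Hh k.+1 l; exists (2 ^+ l * K); exact: decay_coord.
Qed.
End decay.

Section symb.
Variables n M : nat.
Implicit Types (a : 'rV[R]_(n + n) -> R).

(** Derivatives are allowed the same growth exponent [M] as the function. The class is therefore
    stable under [partial] with [M] unchanged, and the number of integrations by parts needed to
    beat weight^M can be fixed in advance. *)
Definition symb (l : nat) (K : R) a := forall w, (size w <= l)%N ->
  forall x y, `|dw w a (row_mx x y)| <= K * (weight x * weight y) ^+ M.

Definition symbol a := smoothr a /\ forall l, exists K, symb l K a.

Lemma symb_ge0 l K a : symb l K a -> 0 <= K.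
Proof.
move=> H; have := le_trans (normr_ge0 _) (H [::] isT 0 0).
by rewrite pmulr_lge0// exprn_gt0// mulr_gt0 ?weight_gt0.
Qed.

Lemma symbW l K l' a : (l' <= l)%N -> symb l K a -> symb l' K a.
Proof. by move=> ll H w wl x; apply: H; exact: leq_trans ll. Qed.

Lemma symb_partial l K a i : symb l.+1 K a -> symb l K (partial i a).
Proof. by move=> H w wl x; apply: (H (i :: w)). Qed.

Lemma symbol_partial a i : symbol a -> symbol (partial i a).
Proof.
move=> [sa Ha]; split=> [|l]; first exact: smoothr_partial.
by have [K HK] := Ha l.+1; exists K; exact: symb_partial.
Qed.
End symb.

End seminorms.

(** * Real oscillatory kernels and their derivatives *)

Section osc_kernel.
Variables (R : realType) (n M : nat).
Implicit Types (a : 'rV[R]_(n + n) -> R) (h : 'rV[R]_n -> R) (x y : 'rV[R]_n) (th : R).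

Definition osc_kernel th a h x y : R :=
  cos (dotrv x y + th) * a (row_mx x y) * h y.

Lemma dotrvC x y : dotrv x y = dotrv y x.
Proof. by apply: eq_bigr => i _; rewrite mulrC. Qed.

Lemma dotrv_line x y s i : dotrv (x + s *: delta_mx 0 i) y = dotrv x y + s * y 0 i.
Proof.
rewrite /dotrv (bigD1 i)//= [in RHS](bigD1 i)//= !mxE !eqxx/= mulr1 mulrDl -!addrA.
congr (_ + _); rewrite addrC; congr (_ + _); apply: eq_bigr => j ji.
by rewrite !mxE eqxx/= (negbTE ji) mulr0 addr0.
Qed.

Lemma smoothr_dotrv x : smoothr (dotrv x).
Proof.
rewrite /dotrv; elim: (index_enum _) => [|i s IH].
  rewrite (_ : (fun y => _) = fun=> 0); first exact: smoothr_cst.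
  by apply/funext => y; rewrite big_nil.
rewrite (_ : (fun y => _) = fun y : 'rV[R]_n =>
    x 0 i * y 0 i + \sum_(i <- s) x 0 i * y 0 i).
  by apply: smoothrD IH; apply: smoothrZ; exact: smoothr_coord.
by apply/funext => y; rewrite big_cons.
Qed.

(** The derivative of the cosine is written as a phase shift by pi/2 rather than as a sine, so that
    derivatives of kernels are again sums of kernels. *)
Lemma is_derive_cos_dotrv x y th i :
  is_derive x (delta_mx 0 i : 'rV[R]_n) (fun x => cos (dotrv x y + th))
    (y 0 i * cos (dotrv x y + (th + pi / 2))).
Proof.
have := (is_derive_lineP (fun x => cos (dotrv x y + th)) x (delta_mx 0 i) 0
  (y 0 i * cos (dotrv x y + (th + pi / 2)))).2.
rewrite scale0r addr0; apply.
rewrite (_ : (fun s => _) = cos \o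
    (fun s : R => cst (dotrv x y + th) s + id s * cst (y 0 i) s)); last first.
  by apply/funext => s; rewrite dotrv_line/= addrAC.
have H := is_deriveD (is_derive_cst (dotrv x y + th) (0 : R) (1 : R))
    (is_deriveM (is_derive_id (0 : R) (1 : R)) (is_derive_cst (y 0 i) (0 : R) (1 : R))).
have := @is_derive1_comp _ cos _ _ _ _ (is_derive_cos _) H.
move=> /is_derive_eq; apply.
rewrite scaler0 !add0r/= [_%:A]mulr1 addrA cosDpihalf mulrC.
congr (_ * - sin _); transitivity (dotrv x y + th + 0 * y 0 i) => [//|].
by rewrite mul0r addr0.
Qed.

Lemma continuous_cos_dotrv x th : continuous (fun y => cos (dotrv x y + th)).
Proof.
have c1 : continuous (fun y => dotrv x y + th).
  by apply/smoothr_continuous/smoothrD; [exact: smoothr_dotrv|exact: smoothr_cst].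
by move=> y; exact: (continuous_comp (c1 y) (@continuous_cos R _)).
Qed.

Lemma row_mx_linel x y s i :
  row_mx (x + s *: delta_mx 0 i) y = row_mx x y + s *: delta_mx 0 (lshift n i).
Proof.
apply/rowP => j; case: (split_ordP j) => k ->.
  by rewrite row_mxEl mxE [RHS]mxE row_mxEl !mxE eqxx/= (inj_eq (@lshift_inj _ _)).
by rewrite row_mxEr [RHS]mxE row_mxEr !mxE eqxx/= eq_rlshift mulr0 addr0.
Qed.

Lemma row_mx_liner x y s i :
  row_mx x (y + s *: delta_mx 0 i) = row_mx x y + s *: delta_mx 0 (rshift n i).
Proof.
apply/rowP => j; case: (split_ordP j) => k ->.
  by rewrite row_mxEl [RHS]mxE row_mxEl !mxE eqxx/= eq_lrshift mulr0 addr0.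
by rewrite row_mxEr mxE [RHS]mxE row_mxEr !mxE eqxx/= (inj_eq (@rshift_inj _ _)).
Qed.

Lemma is_derive_rowl a x y i : smoothr a ->
  is_derive x (delta_mx 0 i : 'rV[R]_n) (fun x => a (row_mx x y))
   (partial (lshift n i) a (row_mx x y)).
Proof.
move=> sa; have D := derivableP (smoothr_derivable (row_mx x y) (lshift n i) sa).
have := (is_derive_lineP (fun x => a (row_mx x y)) x (delta_mx 0 i) 0
  (partial (lshift n i) a (row_mx x y))).2.
rewrite scale0r addr0; apply.
rewrite (_ : (fun s => _) = fun s : R => a (row_mx x y + s *: delta_mx 0 (lshift n i))); last first.
  by apply/funext => s; rewrite row_mx_linel.
by apply/is_derive_lineP; rewrite scale0r addr0.
Qed.

Lemma is_derive_rowr a x y i : smoothr a ->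
  is_derive y (delta_mx 0 i : 'rV[R]_n) (fun y => a (row_mx x y))
   (partial (rshift n i) a (row_mx x y)).
Proof.
move=> sa; have D := derivableP (smoothr_derivable (row_mx x y) (rshift n i) sa).
have := (is_derive_lineP (fun y => a (row_mx x y)) y (delta_mx 0 i) 0
  (partial (rshift n i) a (row_mx x y))).2.
rewrite scale0r addr0; apply.
rewrite (_ : (fun s => _) = fun s : R => a (row_mx x y + s *: delta_mx 0 (rshift n i))); last first.
  by apply/funext => s; rewrite row_mx_liner.
by apply/is_derive_lineP; rewrite scale0r addr0.
Qed.

Lemma ball_row_mx x x' y y' (e : R) :
  ball x e x' -> ball y e y' -> ball (row_mx x y) e (row_mx x' y').
Proof.
move=> [e0 xx] [_ yy]; split=> // i j.
by case: (split_ordP j) => k ->; rewrite ?row_mxEl ?row_mxEr.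
Qed.

Lemma continuous_rowl a y : smoothr a -> continuous (fun x => a (row_mx x y)).
Proof.
move=> /smoothr_continuous ca x.
have c1 : {for x, continuous (fun x => row_mx x y)}.
  apply: (@cvg_ballP _ _ _ _ (nbhs_filter x) (fun x => row_mx x y) _).2 => e e0.
  by apply/nbhs_ballP; exists e => // z; move/ball_row_mx; apply; exact: ballxx.
exact: (continuous_comp c1 (ca _)).
Qed.

Lemma continuous_rowr a x : smoothr a -> continuous (fun y => a (row_mx x y)).
Proof.
move=> /smoothr_continuous ca y.
have c1 : {for y, continuous (fun y => row_mx x y)}.
  apply: (@cvg_ballP _ _ _ _ (nbhs_filter y) (fun y => row_mx x y) _).2 => e e0.
  by apply/nbhs_ballP; exists e => // z; apply: ball_row_mx; exact: ballxx.
exact: (continuous_comp c1 (ca _)).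
Qed.

Lemma osc_kernel_continuousr th a h x : smoothr a -> smoothr h ->
  continuous (osc_kernel th a h x).
Proof.
move=> sa sh y.
have c1 := @continuous_cos_dotrv x th y; have c2 := @continuous_rowr a x sa y.
exact: (continuousM (continuousM c1 c2) (@smoothr_continuous R n h sh y)).
Qed.

Lemma osc_kernel_continuousl th a h y : smoothr a ->
  continuous (fun x => osc_kernel th a h x y).
Proof.
move=> sa.
rewrite (_ : (fun x => _) = fun x => cos (dotrv y x + th) * a (row_mx x y) * h y).
  2: by apply/funext => z; rewrite /osc_kernel dotrvC.
move=> x; have c1 := @continuous_cos_dotrv y th x; have c2 := @continuous_rowl a y sa x.
have c3 : {for x, continuous (fun=> h y : R)} by exact: cst_continuous.
exact: (continuousM (continuousM c1 c2) c3).
Qed.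

Lemma osc_kernel_derivel th a h x y i : smoothr a ->
  is_derive x (delta_mx 0 i : 'rV[R]_n) (fun x => osc_kernel th a h x y)
   (osc_kernel (th + pi / 2) a (fun y => y 0 i * h y) x y +
    osc_kernel th (partial (lshift n i) a) h x y).
Proof.
move=> sa.
have D := is_deriveM (is_deriveM (is_derive_cos_dotrv x y th i) (is_derive_rowl x y i sa))
  (is_derive_cst (h y) x (delta_mx 0 i)).
apply: is_derive_eq D _; rewrite scaler0 add0r /osc_kernel.
have sE (u v : R^o) : u *: v = u * v by [].
by rewrite !sE /cst; ring.
Qed.

Lemma osc_kernel_deriver th a h x y i : smoothr a -> smoothr h ->
  is_derive y (delta_mx 0 i : 'rV[R]_n) (osc_kernel th a h x)
   (x 0 i * osc_kernel (th + pi / 2) a h x y +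
    osc_kernel th (partial (rshift n i) a) h x y +
    osc_kernel th a (partial i h) x y).
Proof.
move=> sa sh.
have D0 := is_derive_cos_dotrv y x th i.
have {}D0 : is_derive y (delta_mx 0 i : 'rV[R]_n) (fun y => cos (dotrv x y + th))
    (x 0 i * cos (dotrv x y + (th + pi / 2))).
  move: D0; rewrite dotrvC; congr is_derive.
  by apply/funext => z; rewrite dotrvC.
have D := is_deriveM (is_deriveM D0 (is_derive_rowr x y i sa))
  (derivableP (smoothr_derivable y i sh)).
apply: is_derive_eq D _; rewrite /osc_kernel /partial.
have sE (u v : R^o) : u *: v = u * v by [].
by rewrite !sE (_ : (_ * _) y = cos (dotrv x y + th) * a (row_mx x y))//; ring.
Qed.

(** Of the [M.+1] orders of decay of h, [M] absorb the growth of a in y and the last one provides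
    the integrable factor 1 / weight y. *)
Lemma osc_kernel_bound th a h K K' x y : symb M 0 K a -> decay M.+1 0 K' h ->
  `|osc_kernel th a h x y| <= (K * K' * weight x ^+ M) / weight y.
Proof.
move=> aK hK; rewrite /osc_kernel !normrM.
have w0 := weight_gt0 y.
have K0 := symb_ge0 aK.
rewrite ler_pdivlMr//.
apply: (@le_trans _ _ (1 * (K * (weight x * weight y) ^+ M) * `|h y| * weight y)).
  rewrite ler_wpM2r ?(ltW w0)// ler_wpM2r// ler_pM//; last exact: (aK [::]).
  by rewrite ler_norml cos_geN1 cos_le1.
rewrite mul1r exprMn.
rewrite (_ : _ * _ = K * weight x ^+ M * (weight y ^+ M.+1 * `|h y|)); last by rewrite exprS; ring.
rewrite (_ : K * K' * weight x ^+ M = K * weight x ^+ M * K') ?ler_wpM2l//; last by ring.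
  by rewrite mulr_ge0// exprn_ge0// ltW// weight_gt0.
exact: (hK [::]).
Qed.

End osc_kernel.

Section osc.
Variables (R : realType) (n M : nat).
Implicit Types (a : 'rV[R]_(n + n) -> R) (h : 'rV[R]_n -> R) (x y : 'rV[R]_n) (th : R).
Local Notation lebn := (lebesgue_Rn R n).
Local Notation symbol := (@symbol R n M).
Local Notation symb := (@symb R n M).

(* The real and imaginary parts of exp(i x.y) are cosines up to the phase th. *)
Definition osc th a h x : R := \int[lebn]_t osc_kernel th a h x (rowt t).

Lemma osc_kernel_bound_ex th a h x : symbol a -> rapid h ->
  exists C, forall y, `|osc_kernel th a h x y| <= C / weight y.
Proof.
move=> [_ /(_ 0%N)[K aK]] [_ /(_ M.+1 0%N)[K' hK]].
by exists (K * K' * weight x ^+ M) => y; exact: osc_kernel_bound.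
Qed.

Lemma osc_integrable th a h x : symbol a -> rapid h ->
  lebn.-integrable setT (fun t => (osc_kernel th a h x (rowt t))%:E).
Proof.
move=> sa sh; have [C HC] := osc_kernel_bound_ex th x sa sh.
exact: integrable_rowt (osc_kernel_continuousr sa.1 sh.1) HC.
Qed.

Lemma osc_le th a h x K K' : symbol a -> rapid h ->
  symb 0 K a -> decay M.+1 0 K' h ->
  `|osc th a h x| <= K * K' * weight x ^+ M * weight_int R n.
Proof.
move=> [sa _] [sh _] aK hK.
apply: (normr_Rintegral_rowt_le (osc_kernel_continuousr (th := th) (x := x) sa sh)).
by move=> y; exact: osc_kernel_bound.
Qed.

Lemma weight_near x : exists W : R, forall x', `|x' - x| <= 1 -> weight x' <= W.
Proof.
exists (\prod_i (1 + (`|x 0 i| + 1) ^+ 2)) => x' xx'.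
apply: ler_prod => i _; rewrite addr_ge0 ?sqr_ge0//= lerD2l.
rewrite -[x' 0 i ^+ 2]real_normK ?num_real// lerXn2r ?nnegrE ?addr_ge0//.
have : `|x' 0 i - x 0 i| <= 1.
  apply: le_trans xx'; rewrite [leRHS]/Num.Def.normr /= mx_normrE.
  by apply/bigmax_geP; right => /=; exists (0, i); rewrite ?mxE.
by have := ler_normD (x' 0 i - x 0 i) (x 0 i); rewrite subrK; lra.
Qed.

Lemma osc_kernel_bound_near th a h x : symbol a -> rapid h ->
  exists C, forall x' y, `|x' - x| <= 1 -> `|osc_kernel th a h x' y| <= C / weight y.
Proof.
move=> [_ /(_ 0%N)[K aK]] [_ /(_ M.+1 0%N)[K' hK]].
have [W HW] := weight_near x; exists (K * K' * W ^+ M) => x' y xx'.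
apply: le_trans (osc_kernel_bound th x' y aK hK) _.
rewrite ler_wpM2r ?weightV_ge0// ler_wpM2l//.
  by rewrite mulr_ge0// ?(symb_ge0 aK) ?(decay_ge0 hK).
by rewrite lerXn2r ?nnegrE ?HW ?weight_ge0// (le_trans _ (HW _ xx')) ?weight_ge0.
Qed.

Lemma osc_continuous th a h : symbol a -> rapid h -> continuous (osc th a h).
Proof.
move=> sa sh x; have [C HC] := osc_kernel_bound_near th x sa sh.
apply: (@continuous_param_integral R n n (osc_kernel th a h) C) => //.
- by move=> x'; exact: (osc_kernel_continuousr sa.1 sh.1).
- by move=> y; exact: (@osc_kernel_continuousl R n th a h y sa.1 x).
Qed.

Lemma osc_derive th a h x i : symbol a -> rapid h ->
  is_derive x (delta_mx 0 i : 'rV[R]_n) (osc th a h)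
   (osc (th + pi / 2) a (fun y => y 0 i * h y) x +
    osc th (partial (lshift n i) a) h x).
Proof.
move=> sa sh; have [C HC] := osc_kernel_bound_near th x sa sh.
have sa' := symbol_partial (lshift n i) sa; have sh' := rapid_coord i sh.
have [C1 HC1] := osc_kernel_bound_near (th + pi / 2) x sa sh'.
have [C2 HC2] := osc_kernel_bound_near th x sa' sh.
have pE x' y : partial i (fun x => osc_kernel th a h x y) x' =
   osc_kernel (th + pi / 2) a (fun y => y 0 i * h y) x' y +
    osc_kernel th (partial (lshift n i) a) h x' y.
  by have [_] := osc_kernel_derivel th h x' y i sa.1.
have C_ge0 (D : R) (f : 'rV[R]_n -> 'rV[R]_n -> R) :
    (forall x' y, `|x' - x| <= 1 -> `|f x' y| <= D / weight y) -> 0 <= D.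
  move=> /(_ x 0); rewrite subrr normr0 => /(_ ler01) /(le_trans (normr_ge0 _)).
  by rewrite pmulr_lge0// invr_gt0 weight_gt0.
have [C0 C10 C20] := And3 (C_ge0 _ _ HC) (C_ge0 _ _ HC1) (C_ge0 _ _ HC2).
have := @is_derive_param_integral R n n (osc_kernel th a h) (C + C1 + C2) x i.
move=> /(_ _ _ _ _)/is_derive_eq; apply.
- by move=> x'; exact: (osc_kernel_continuousr sa.1 sh.1).
- by move=> x' y; have [] := osc_kernel_derivel th h x' y i sa.1.
- move=> x' y xx'; apply: le_trans (HC _ _ xx') _.
  by rewrite ler_wpM2r ?weightV_ge0// -addrA lerDl addr_ge0.
- move=> x' y xx'; rewrite pE (le_trans (ler_normD _ _))//.
  apply: (@le_trans _ _ (C1 / weight y + C2 / weight y)); first by rewrite lerD ?HC1 ?HC2.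
  by rewrite -mulrDl ler_wpM2r ?weightV_ge0// -addrA lerDr.
- rewrite /osc -RintegralD//; [|exact: osc_integrable..].
  by apply: eq_Rintegral => t _; rewrite pE.
Qed.

Lemma osc_partial th a h i : symbol a -> rapid h ->
  partial i (osc th a h) = (fun x => osc (th + pi / 2) a (fun y => y 0 i * h y) x +
    osc th (partial (lshift n i) a) h x).
Proof. by move=> sa sh; apply/funext => x; have [_] := osc_derive th x i sa sh. Qed.

(** Each partial derivative is a sum of two integrals of the same form, so an induction on the order
    works for all [th], [a], [h] at once. *)
Lemma osc_smoothr th a h : symbol a -> rapid h -> smoothr (osc th a h).
Proof.
move=> sa sh k; elim: k th a h sa sh => [|k IH] th a h sa sh /=.
  exact: osc_continuous.
split=> [|i]; first exact: osc_continuous.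
split=> [x|]; first by have [] := osc_derive th x i sa sh.
rewrite osc_partial//; apply: of_class_CD; apply: IH => //.
  exact: rapid_coord.
exact: symbol_partial.
Qed.

(** Integration by parts in y: a factor x_i is traded for one derivative, which falls on a or on
    h. *)
Lemma osc_coord th a h x i : symbol a -> rapid h ->
  x 0 i * osc th a h x = osc (th + pi / 2) (partial (rshift n i) a) h x +
    osc (th + pi / 2) a (partial i h) x.
Proof.
(* With this phase, the derivative of the cosine in y is exactly x_i cos(x.y + th). The other two
   terms carry the phase th - pi/2, which is opposite to th + pi/2; this absorbs the sign of the
   integration by parts. *)
move=> sa sh; pose th' := th - pi / 2.
have thE : th' + pi / 2 = th by rewrite subrK.
have sa' := symbol_partial (rshift n i) sa; have sh' := rapid_partial i sh.
have pE : partial i (osc_kernel th' a h x) = fun y =>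
   x 0 i * osc_kernel th a h x y +
    osc_kernel th' (partial (rshift n i) a) h x y +
    osc_kernel th' a (partial i h) x y.
  apply/funext => y.
  by have [_] := osc_kernel_deriver th' x y i sa.1 sh.1; rewrite thE.
have kN a' h' y : osc_kernel th' a' h' x y = - osc_kernel (th + pi / 2) a' h' x y.
  by rewrite /osc_kernel /th' !addrA cosDpihalf cosBpihalf !mulNr opprK.
have [C HC] := osc_kernel_bound_ex th x sa sh.
have [C' HC'] := osc_kernel_bound_ex th' x sa sh.
have [C1 HC1] := osc_kernel_bound_ex th' x sa' sh.
have [C2 HC2] := osc_kernel_bound_ex th' x sa sh'.
have C_ge0 (D : R) (f : 'rV[R]_n -> R) :
    (forall y, `|f y| <= D / weight y) -> 0 <= D.
  move=> /(_ 0) /(le_trans (normr_ge0 _)).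
  by rewrite pmulr_lge0// invr_gt0 weight_gt0.
have [D0 D'0] := (C_ge0 _ _ HC, C_ge0 _ _ HC').
have [D10 D20] := (C_ge0 _ _ HC1, C_ge0 _ _ HC2).
have := @integral_partial R n (osc_kernel th' a h x) (`|x 0 i| * C + C1 + C2 + C') i.
move=> /(_ _ _ _ _ _) I0.
have {}I0 : \int[lebn]_t partial i (osc_kernel th' a h x) (rowt t) = 0.
  rewrite /Rintegral I0//.
  - by move=> y; have [] := osc_kernel_deriver th' x y i sa.1 sh.1.
  - exact: (osc_kernel_continuousr sa.1 sh.1).
  - rewrite pE => y.
    have c1 : {for y, continuous (fun=> x 0 i : R)} by exact: cst_continuous.
    have c2 := @osc_kernel_continuousr R n th a h x sa.1 sh.1 y.
    have c3 := @osc_kernel_continuousr R n th' _ h x sa'.1 sh.1 y.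
    have c4 := @osc_kernel_continuousr R n th' a _ x sa.1 sh'.1 y.
    exact: (continuousD (continuousD (continuousM c1 c2) c3) c4).
  - move=> y; rewrite (le_trans (HC' y))// ler_wpM2r ?weightV_ge0//.
    by rewrite ler_wpDl// !addr_ge0// mulr_ge0.
  - move=> y; rewrite pE [X in _ <= X]mulrDl ler_wpDr//.
      by rewrite mulr_ge0// weightV_ge0.
    rewrite !mulrDl (le_trans (ler_normD _ _))// lerD// (le_trans (ler_normD _ _))// lerD//.
    by rewrite normrM -mulrA ler_wpM2l.
pose k0 t := osc_kernel th a h x (rowt t).
pose k1 t := osc_kernel (th + pi / 2) (partial (rshift n i) a) h x (rowt t).
pose k2 t := osc_kernel (th + pi / 2) a (partial i h) x (rowt t).
have i0 : lebn.-integrable setT (EFin \o k0) by exact: osc_integrable.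
have i1 : lebn.-integrable setT (EFin \o k1) by exact: osc_integrable.
have i2 : lebn.-integrable setT (EFin \o k2) by exact: osc_integrable.
have iZ : lebn.-integrable setT (EFin \o (fun t => x 0 i * k0 t)).
  exact: (integrableZl measurableT (x 0 i) i0).
have iB : lebn.-integrable setT (EFin \o (fun t => x 0 i * k0 t - k1 t)).
  exact: (integrableB measurableT iZ i1).
move: I0; rewrite (_ : (fun t => _) = fun t => x 0 i * k0 t - k1 t - k2 t); last first.
  by apply/funext => t; rewrite pE !kN.
rewrite (RintegralB measurableT iB i2) (RintegralB measurableT iZ i1).
rewrite (RintegralZl _ measurableT i0).
by rewrite /osc -/k0 -/k1 -/k2; lra.
Qed.

End osc.

(** * Decay of oscillatory integrals by repeated integration by parts *)

Section osc_decay.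
Variables (R : realType) (n M : nat).
Implicit Types (a : 'rV[R]_(n + n) -> R) (h : 'rV[R]_n -> R) (x y : 'rV[R]_n) (th : R).
Local Notation symbol := (@symbol R n M).
Local Notation symb := (@symb R n M).

(** [osc_coord] applied twice. The two equal cross terms are not merged: five integrals of the same
    kind remain, whence the base 5 in the bounds that follow. *)
Lemma osc_mul1Dsqr th a h x i : symbol a -> rapid h ->
  let T := osc (th + pi / 2 + pi / 2) in
  let da := partial (rshift n i) a in let dh := partial i h in
  (1 + x 0 i ^+ 2) * osc th a h x = osc th a h x +
    T (partial (rshift n i) da) h x + T da dh x + T da dh x + T a (partial i dh) x.
Proof.
move=> sa sh /=.
have sa' := symbol_partial (rshift n i) sa; have sh' := rapid_partial i sh.
have e0 := @osc_coord R n M th a h x i sa sh.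
have e1 := @osc_coord R n M (th + pi / 2) _ h x i sa' sh.
have e2 := @osc_coord R n M (th + pi / 2) a _ x i sa sh'.
have aux (y T A B A' B' C' D' : R) : y * T = A + B -> y * A = A' + B' ->
    y * B = C' + D' -> (1 + y ^+ 2) * T = T + A' + B' + C' + D'.
  by move=> E0 E1 E2; rewrite mulrDl mul1r expr2 -mulrA E0 mulrDr E1 E2 !addrA.
exact: aux e0 e1 e2.
Qed.

(** [v] lists coordinates with repetition. Each entry uses up two derivatives of a and of h and
    multiplies the number of terms by five; once the list is exhausted, [osc_le] bounds each
    term. *)
Lemma osc_prod_le v : forall th a h x K K', symbol a -> rapid h ->
  symb (2 * size v) K a -> decay M.+1 (2 * size v) K' h ->
  `|\prod_(i <- v) (1 + x 0 i ^+ 2) * osc th a h x| <=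
  5 ^+ size v * (K * K' * weight x ^+ M * weight_int R n).
Proof.
elim: v => [|i v IH] th a h x K K' sa sh aK hK.
  by rewrite big_nil !mul1r; exact: osc_le.
have sa' := symbol_partial (rshift n i) sa; have sh' := rapid_partial i sh.
have aK0 : symb (2 * size v) K a.
  by apply: symbW aK; rewrite leq_mul2l/= leqnSn.
have hK0 : decay M.+1 (2 * size v) K' h.
  by apply: decayW hK => //; rewrite leq_mul2l/= leqnSn.
have dM : (2 * size (i :: v) = (2 * size v).+2)%N by rewrite /= mulnS.
rewrite dM in aK hK.
rewrite big_cons -mulrA mulrCA (@osc_mul1Dsqr th a h x i sa sh) !mulrDr.
have -> : forall B : R, 5 ^+ size (i :: v) * B = 5 ^+ size v * B + 5 ^+ size v * B +
   5 ^+ size v * B + 5 ^+ size v * B + 5 ^+ size v * B.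
  by move=> B /=; rewrite exprS; ring.
have aux (A B C D E L : R) : `|A| <= L -> `|B| <= L -> `|C| <= L -> `|D| <= L ->
    `|E| <= L -> `|A + B + C + D + E| <= L + L + L + L + L.
  by move=> *; do 4!(apply: le_trans (ler_normD _ _) _; apply: lerD => //).
apply: aux; apply: IH => //.
- exact: symbol_partial.
- exact/symb_partial/symb_partial.
- by apply: symb_partial; exact: symbW aK.
- by apply: decay_partial; exact: decayW hK.
- by apply: symb_partial; exact: symbW aK.
- by apply: decay_partial; exact: decayW hK.
- exact: rapid_partial.
- exact/decay_partial/decay_partial.
Qed.

(** The list takes every coordinate [M + p] times, so its product is weight^(M+p). The exponent [M]
    cancels the growth weight^M in x left by [osc_le], and [p] is the decay gained. The list has
    n(M+p) entries, hence 2n(M+p) derivatives. *)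
Lemma osc_weight_le p th a h x K K' : symbol a -> rapid h ->
  symb (2 * (n * (M + p))) K a -> decay M.+1 (2 * (n * (M + p))) K' h ->
  weight x ^+ p * `|osc th a h x| <= 5 ^+ (n * (M + p)) * weight_int R n * (K * K').
Proof.
move=> sa sh aK hK.
pose v := flatten (nseq (M + p) (index_enum 'I_n)).
have sv : size v = (n * (M + p))%N.
  rewrite /v size_flatten /shape map_nseq sumn_nseq; congr (_ * _)%N.
  by rewrite -[RHS]card_ord cardT enumT.
have := @osc_prod_le v th a h x K K' sa sh; rewrite sv => /(_ aK hK).
have wM : 0 < weight x ^+ M by rewrite exprn_gt0// weight_gt0.
rewrite prod_weightX normrM ger0_norm ?exprn_ge0 ?weight_ge0// => H.
rewrite -(ler_pM2l wM) [leLHS]mulrA -exprD; apply: le_trans H _.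
by rewrite le_eqVlt; apply/orP; left; apply/eqP; ring.
Qed.

Lemma weight_int_ge0 : 0 <= weight_int R n.
Proof. by apply: Rintegral_ge0 => t _; exact: weightV_ge0. Qed.

(** A derivative in x either multiplies h by y_i, which costs one order of decay and the factor
    2^(2n(M+p)) of [decay_coord], or falls on a. It never differentiates h, so the order 2n(M+p)
    does not grow with [w]. *)
Lemma osc_dw_le p w : forall th a h x K K', symbol a -> rapid h ->
  symb (2 * (n * (M + p)) + size w) K a ->
  decay (M.+1 + size w) (2 * (n * (M + p))) K' h ->
  weight x ^+ p * `|dw w (osc th a h) x| <=
  (2 ^+ (2 * (n * (M + p))) + 1) ^+ size w *
    (5 ^+ (n * (M + p)) * weight_int R n * (K * K')).
Proof.
elim: w => [|i w IH] th a h x K K' sa sh aK hK.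
  by rewrite mul1r; apply: osc_weight_le => //; [apply: symbW aK|apply: decayW hK];
    rewrite ?addn0.
rewrite /= (@osc_partial R n M th a h i sa sh).
have sa' := symbol_partial (lshift n i) sa; have sh' := rapid_coord i sh.
rewrite dwD; [|exact: (@osc_smoothr R n M)..].
rewrite [leRHS](_ : _ = (2 ^+ (2 * (n * (M + p))) + 1) ^+ size w *
   (5 ^+ (n * (M + p)) * weight_int R n * (K * (2 ^+ (2 * (n * (M + p))) * K'))) +
   (2 ^+ (2 * (n * (M + p))) + 1) ^+ size w *
   (5 ^+ (n * (M + p)) * weight_int R n * (K * K'))); last by rewrite exprS; ring.
apply: le_trans (ler_wpM2l _ (ler_normD _ _)) _; first by rewrite exprn_ge0// weight_ge0.
rewrite mulrDr lerD//; apply: IH => //.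
- by apply: symbW aK; rewrite leq_add2l leqnSn.
- by apply: decay_coord; [exact: sh.1|rewrite -addnS].
- by apply: symb_partial; rewrite -addnS.
- by apply: decayW hK => //; rewrite leq_add2l leqnSn.
Qed.

(** The orders and [C] come before the functions, and the bound is bilinear in [K] and [K'], so the
    powers of eps carried by these simply multiply. The derivative order 2n(M+p) is kept explicit
    because it is free of [r] and vanishes for M = p = 0. *)
Lemma osc_decay p r : exists k l C, 0 <= C /\
  forall th a h K K', symbol a -> rapid h ->
  symb l K a -> decay k (2 * (n * (M + p))) K' h ->
  decay p r (C * (K * K')) (osc th a h).
Proof.
exists (M.+1 + r)%N, (2 * (n * (M + p)) + r)%N.
exists ((2 ^+ (2 * (n * (M + p))) + 1) ^+ r * (5 ^+ (n * (M + p)) * weight_int R n)).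
split; first by rewrite !mulr_ge0// ?exprn_ge0// ?addr_ge0 ?exprn_ge0// weight_int_ge0.
move=> th a h K K' sa sh aK hK w wr x.
apply: le_trans (@osc_dw_le p w th a h x K K' sa sh _ _) _.
- by apply: symbW aK; rewrite leq_add2l.
- by apply: decayW hK => //; rewrite leq_add2l.
rewrite -!mulrA ler_wpM2r//.
  rewrite !mulr_ge0 ?exprn_ge0 ?weight_int_ge0 ?(symb_ge0 aK) ?(decay_ge0 hK)//.
by rewrite ler_weXn2l// lerDr exprn_ge0.
Qed.

Lemma osc_rapid th a h : symbol a -> rapid h -> rapid (osc th a h).
Proof.
move=> sa sh; split=> [|p r]; first exact: (@osc_smoothr R n M).
have [k [l [C [C0 HC]]]] := osc_decay p r.
have [K aK] := sa.2 l; have [K' hK] := sh.2 k (2 * (n * (M + p)))%N.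
by exists (C * (K * K')); exact: HC.
Qed.

End osc_decay.

Section decay_sum.
Variables (R : realType) (n : nat).
Implicit Types f g : 'rV[R]_n -> R.

Lemma decayD k l K K' f g : smoothr f -> smoothr g ->
  decay k l K f -> decay k l K' g -> decay k l (K + K') (fun x => f x + g x).
Proof.
move=> sf sg fK gK w wl x; rewrite dwD//.
apply: le_trans (ler_wpM2l _ (ler_normD _ _)) _; first by rewrite exprn_ge0// weight_ge0.
by rewrite mulrDr lerD// ?fK ?gK.
Qed.

Lemma decayZ k l K c f : smoothr f ->
  decay k l K f -> decay k l (`|c| * K) (fun x => c * f x).
Proof. by move=> sf fK w wl x; rewrite dwZ// normrM mulrCA ler_wpM2l// fK. Qed.

Lemma rapidD f g : rapid f -> rapid g -> rapid (fun x => f x + g x).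
Proof.
move=> [sf Hf] [sg Hg]; split=> [|k l]; first exact: smoothrD.
by have [[K fK] [K' gK]] := (Hf k l, Hg k l); exists (K + K'); exact: decayD.
Qed.

End decay_sum.

(** * Complex-valued functions and the Fourier transform *)

Section complex_seminorms.
Variables (R : realType).
Local Notation Re := (@complex.Re R).
Local Notation Im := (@complex.Im R).

Lemma Re_mul (z w : R[i]) : Re (z * w) = Re z * Re w - Im z * Im w.
Proof. by case: z => a b; case: w. Qed.

Lemma Im_mul (z w : R[i]) : Im (z * w) = Re z * Im w + Im z * Re w.
Proof. by case: z => a b; case: w. Qed.

Lemma Re_add (z w : R[i]) : Re (z + w) = Re z + Re w.
Proof. by case: z => a b; case: w. Qed.

Lemma Im_add (z w : R[i]) : Im (z + w) = Im z + Im w.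
Proof. by case: z => a b; case: w. Qed.

Lemma complex_eq (z w : R[i]) : Re z = Re w -> Im z = Im w -> z = w.
Proof. by case: z => a b; case: w => c d /= -> ->. Qed.

Section cdecay.
Variable n : nat.
Implicit Types (u v : 'rV[R]_n -> R[i]).

Definition csmooth u := smoothr (Re \o u) /\ smoothr (Im \o u).

Definition cdecay k l K u := decay k l K (Re \o u) /\ decay k l K (Im \o u).

Definition crapid u := rapid (Re \o u) /\ rapid (Im \o u).

Lemma csmoothE u : csmooth u <-> smooth u.
Proof. by split=> [[s1 s2] k|s]; split=> //; move=> k; have [] := s k. Qed.

Lemma crapid_smooth u : crapid u -> csmooth u.
Proof. by move=> [[s1 _] [s2 _]]. Qed.

Lemma cdecay_ge0 k l K u : cdecay k l K u -> 0 <= K.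
Proof. by move=> [/decay_ge0]. Qed.

Lemma crapid_ex k l u : crapid u -> exists K, cdecay k l K u.
Proof.
move=> [[_ H1] [_ H2]]; have [[K1 d1] [K2 d2]] := (H1 k l, H2 k l).
exists (Num.max K1 K2); split.
  by apply: decayW d1; rewrite ?le_max ?lexx.
by apply: decayW d2; rewrite ?le_max ?lexx ?orbT.
Qed.

Lemma crapidP u : csmooth u -> (forall k l, exists K, cdecay k l K u) -> crapid u.
Proof.
move=> [s1 s2] H; split; split=> // k l; have [K [d1 d2]] := H k l; by exists K.
Qed.

Lemma csmoothM u v : csmooth u -> csmooth v -> csmooth (fun x => u x * v x).
Proof.
move=> [u1 u2] [v1 v2]; split.
- rewrite (_ : _ \o _ = fun x => Re (u x) * Re (v x) + (-1) * (Im (u x) * Im (v x))).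
    by apply: smoothrD; [|apply: smoothrZ]; exact: smoothrM.
  by apply/funext => x; rewrite /= Re_mul mulN1r.
- rewrite (_ : _ \o _ = fun x => Re (u x) * Im (v x) + Im (u x) * Re (v x)).
    by apply: smoothrD; exact: smoothrM.
  by apply/funext => x; rewrite /= Im_mul.
Qed.

Lemma csmoothD u v : csmooth u -> csmooth v -> csmooth (fun x => u x + v x).
Proof.
move=> [u1 u2] [v1 v2]; split.
- rewrite (_ : _ \o _ = fun x => Re (u x) + Re (v x)); first exact: smoothrD.
  by apply/funext => x; rewrite /= Re_add.
- rewrite (_ : _ \o _ = fun x => Im (u x) + Im (v x)); first exact: smoothrD.
  by apply/funext => x; rewrite /= Im_add.
Qed.

Lemma csmooth_cst (c : R[i]) : csmooth (fun=> c).
Proof. by split; exact: smoothr_cst. Qed.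

Lemma cdecayD k l K K' u v : csmooth u -> csmooth v ->
  cdecay k l K u -> cdecay k l K' v -> cdecay k l (K + K') (fun x => u x + v x).
Proof.
move=> [su1 su2] [sv1 sv2] [u1 u2] [v1 v2]; split.
- rewrite (_ : _ \o _ = fun x => Re (u x) + Re (v x)); first exact: decayD.
  by apply/funext => x; rewrite /= Re_add.
- rewrite (_ : _ \o _ = fun x => Im (u x) + Im (v x)); first exact: decayD.
  by apply/funext => x; rewrite /= Im_add.
Qed.

Lemma cdecayM k k' l A K u v : csmooth u -> csmooth v -> 0 <= A ->
  (forall w x, (size w <= l)%N -> `|dw w (Re \o u) x| <= A * weight x ^+ k' /\
      `|dw w (Im \o u) x| <= A * weight x ^+ k') ->
  cdecay (k + k') l K v ->
  cdecay k l (2 * (2 ^+ l * (A * K))) (fun x => u x * v x).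
Proof.
move=> [u1 u2] [v1 v2] A0 uA [d1 d2].
have uA1 w x : (size w <= l)%N -> `|dw w (Re \o u) x| <= A * weight x ^+ k'.
  by move=> wl; have [] := uA w x wl.
have uA2 w x : (size w <= l)%N -> `|dw w (Im \o u) x| <= A * weight x ^+ k'.
  by move=> wl; have [] := uA w x wl.
rewrite mulr2n mulrDl mul1r; split.
- rewrite (_ : _ \o _ = fun x => Re (u x) * Re (v x) + (-1) * (Im (u x) * Im (v x))).
    apply: decayD.
    + exact: smoothrM.
    + by apply: smoothrZ; exact: smoothrM.
    + exact: (decayM u1 v1 A0 uA1 d1).
    + have := decayZ (-1) (smoothrM u2 v2) (decayM u2 v2 A0 uA2 d2).
      by rewrite normrN1 mul1r.
  by apply/funext => x; rewrite /= Re_mul mulN1r.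
- rewrite (_ : _ \o _ = fun x => Re (u x) * Im (v x) + Im (u x) * Re (v x)).
    apply: decayD.
    + exact: smoothrM.
    + exact: smoothrM.
    + exact: (decayM u1 v2 A0 uA1 d2).
    + exact: (decayM u2 v1 A0 uA2 d1).
  by apply/funext => x; rewrite /= Im_mul.
Qed.

Lemma cdecayZ k l K (c : R[i]) u : csmooth u ->
  cdecay k l K u -> cdecay k l (2 * (2 ^+ l * (Normc.normc c * K))) (fun x => c * u x).
Proof.
move=> su du.
apply: (@cdecayM k 0) => //; [exact: csmooth_cst|exact: normc_nonneg| |by rewrite addn0].
move=> w x _; rewrite expr0 mulr1; split; apply: le_trans (dw_cst _ _ _) _.
  exact: Re_le_normc.
exact: Im_le_normc.
Qed.

End cdecay.

Section csymb.
Variables n M : nat.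
Implicit Types a : 'rV[R]_(n + n) -> R[i].

Definition csymb l K a := symb M l K (Re \o a) /\ symb M l K (Im \o a).
Definition csymbol a := symbol M (Re \o a) /\ symbol M (Im \o a).

End csymb.

Section opQ.
Variables n M : nat.
Implicit Types (a : 'rV[R]_(n + n) -> R[i]) (u v : 'rV[R]_n -> R[i]) (x y : 'rV[R]_n).
Local Notation lebn := (lebesgue_Rn R n).
Local Notation csymbol := (@csymbol n M).
Local Notation csymb := (@csymb n M).

(* Up to the factor (2 pi)^-n, [opQ a] is the pseudo-differential operator with
   symbol a applied to the function whose Fourier transform is u. *)
Definition opQ_kernel a u x y : R[i] := cexpi (dotrv x y) * a (row_mx x y) * u y.

Definition opQ a u x : R[i] := cintegral (opQ_kernel a u x).

(** Expanding the product, the factors cos, -cos and -sin are cosines with phases 0, pi and pi/2, so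
    no sign remains in front of a kernel; in the imaginary part sin has phase -pi/2. *)
Lemma Re_opQ_kernel a u x y : Re (opQ_kernel a u x y) =
  osc_kernel 0 (Re \o a) (Re \o u) x y +
  osc_kernel (pi / 2 + pi / 2) (Im \o a) (Im \o u) x y +
  osc_kernel (pi / 2) (Re \o a) (Im \o u) x y +
  osc_kernel (pi / 2) (Im \o a) (Re \o u) x y.
Proof.
rewrite /opQ_kernel /osc_kernel !(Re_mul, Im_mul) /= addr0 addrA !cosDpihalf sinDpihalf.
ring.
Qed.

Lemma Im_opQ_kernel a u x y : Im (opQ_kernel a u x y) =
  osc_kernel 0 (Re \o a) (Im \o u) x y +
  osc_kernel 0 (Im \o a) (Re \o u) x y +
  osc_kernel (- (pi / 2)) (Re \o a) (Re \o u) x y +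
  osc_kernel (pi / 2) (Im \o a) (Im \o u) x y.
Proof.
rewrite /opQ_kernel /osc_kernel !(Re_mul, Im_mul) /= addr0 !cosDpihalf cosBpihalf.
ring.
Qed.

Lemma integrable_sum4 (f1 f2 f3 f4 : Rtuple R n -> R) :
  lebn.-integrable setT (EFin \o f1) -> lebn.-integrable setT (EFin \o f2) ->
  lebn.-integrable setT (EFin \o f3) -> lebn.-integrable setT (EFin \o f4) ->
  lebn.-integrable setT (EFin \o (fun t => f1 t + f2 t + f3 t + f4 t)) /\
  \int[lebn]_t (f1 t + f2 t + f3 t + f4 t) =
  \int[lebn]_t f1 t + \int[lebn]_t f2 t + \int[lebn]_t f3 t + \int[lebn]_t f4 t.
Proof.
move=> i1 i2 i3 i4.
have i12 : lebn.-integrable setT (EFin \o (fun t => f1 t + f2 t)).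
  exact: (integrableD measurableT i1 i2).
have i123 : lebn.-integrable setT (EFin \o (fun t => f1 t + f2 t + f3 t)).
  exact: (integrableD measurableT i12 i3).
split; first exact: (integrableD measurableT i123 i4).
by rewrite (RintegralD measurableT i123 i4) (RintegralD measurableT i12 i3)
  (RintegralD measurableT i1 i2).
Qed.

Section rapid_u.
Variables (a : 'rV[R]_(n + n) -> R[i]) (u : 'rV[R]_n -> R[i]).
Hypotheses (sa : csymbol a) (su : crapid u).

Let i11 th x := osc_integrable th x sa.1 su.1.
Let i12 th x := osc_integrable th x sa.1 su.2.
Let i21 th x := osc_integrable th x sa.2 su.1.
Let i22 th x := osc_integrable th x sa.2 su.2.

Lemma opQ_integrable x :
  lebn.-integrable setT (EFin \o (fun t => Re (opQ_kernel a u x (rowt t)))) /\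
  lebn.-integrable setT (EFin \o (fun t => Im (opQ_kernel a u x (rowt t)))).
Proof.
split.
- under eq_fun do rewrite /= Re_opQ_kernel.
  exact: (integrable_sum4 (i11 _ x) (i22 _ x) (i12 _ x) (i21 _ x)).1.
- under eq_fun do rewrite /= Im_opQ_kernel.
  exact: (integrable_sum4 (i12 _ x) (i21 _ x) (i11 _ x) (i22 _ x)).1.
Qed.

Lemma Re_opQ : Re \o opQ a u = fun x =>
  osc 0 (Re \o a) (Re \o u) x + osc (pi / 2 + pi / 2) (Im \o a) (Im \o u) x +
  osc (pi / 2) (Re \o a) (Im \o u) x + osc (pi / 2) (Im \o a) (Re \o u) x.
Proof.
apply/funext => x; rewrite /= -(integrable_sum4 (i11 _ x) (i22 _ x) (i12 _ x) (i21 _ x)).2.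
by apply: eq_Rintegral => t _; rewrite Re_opQ_kernel.
Qed.

Lemma Im_opQ : Im \o opQ a u = fun x =>
  osc 0 (Re \o a) (Im \o u) x + osc 0 (Im \o a) (Re \o u) x +
  osc (- (pi / 2)) (Re \o a) (Re \o u) x + osc (pi / 2) (Im \o a) (Im \o u) x.
Proof.
apply/funext => x; rewrite /= -(integrable_sum4 (i12 _ x) (i21 _ x) (i11 _ x) (i22 _ x)).2.
by apply: eq_Rintegral => t _; rewrite Im_opQ_kernel.
Qed.

Lemma opQ_crapid : crapid (opQ a u).
Proof.
have [[sa1 sa2] [su1 su2]] := (sa, su).
by split; rewrite ?Re_opQ ?Im_opQ; do 3 (apply: rapidD; last exact: (@osc_rapid R n M));
  exact: (@osc_rapid R n M).
Qed.

End rapid_u.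

Lemma opQ_decay p r : exists k l C, 0 <= C /\
  forall a u K K', csymbol a -> crapid u ->
  csymb l K a -> cdecay k (2 * (n * (M + p))) K' u ->
  cdecay p r (C * (K * K')) (opQ a u).
Proof.
have [k [l [C [C0 HC]]]] := @osc_decay R n M p r.
(* Each of the two parts of [opQ a u] is a sum of four real oscillatory integrals. *)
exists k, l, (4 * C); split; first by rewrite mulr_ge0.
move=> a u K K' sa su [a1 a2] [u1 u2].
have [[sa1 sa2] [su1 su2]] := (sa, su).
have -> : 4 * C * (K * K') = C * (K * K') + C * (K * K') + C * (K * K') + C * (K * K').
  by ring.
have S th b h := @osc_smoothr R n M th b h.
split; rewrite ?Re_opQ// ?Im_opQ//; do 3 (apply: decayD;
  [by do ?apply: smoothrD; exact: S|exact: S| |exact: HC]); exact: HC.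
Qed.

Lemma opQ_linear a u v (c : R[i]) x : csymbol a -> crapid u -> crapid v ->
  opQ a (fun y => c * u y + v y) x = c * opQ a u x + opQ a v x.
Proof.
move=> sa su sv.
have [u1 u2] := opQ_integrable sa su x; have [v1 v2] := opQ_integrable sa sv x.
have kE y : opQ_kernel a (fun y => c * u y + v y) x y =
    c * opQ_kernel a u x y + opQ_kernel a v x y.
  by rewrite /opQ_kernel mulrDr mulrCA.
apply: complex_eq; rewrite ?Re_add ?Im_add ?Re_mul ?Im_mul /opQ /cintegral /=.
- have j1 : lebn.-integrable setT (EFin \o (fun t => Re c * Re (opQ_kernel a u x (rowt t)))).
    exact: (integrableZl measurableT _ u1).
  have j2 : lebn.-integrable setT (EFin \o (fun t => Im c * Im (opQ_kernel a u x (rowt t)))).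
    exact: (integrableZl measurableT _ u2).
  have j3 : lebn.-integrable setT (EFin \o (fun t => Re c * Re (opQ_kernel a u x (rowt t))
       - Im c * Im (opQ_kernel a u x (rowt t)))).
    exact: (integrableB measurableT j1 j2).
  rewrite -(RintegralZl _ measurableT u1) -(RintegralZl _ measurableT u2).
  rewrite -(RintegralB measurableT j1 j2) -(RintegralD measurableT j3 v1).
  by apply: eq_Rintegral => t _; rewrite kE Re_add Re_mul.
- have j1 : lebn.-integrable setT (EFin \o (fun t => Re c * Im (opQ_kernel a u x (rowt t)))).
    exact: (integrableZl measurableT _ u2).
  have j2 : lebn.-integrable setT (EFin \o (fun t => Im c * Re (opQ_kernel a u x (rowt t)))).
    exact: (integrableZl measurableT _ u1).
  have j3 : lebn.-integrable setT (EFin \o (fun t => Re c * Im (opQ_kernel a u x (rowt t))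
       + Im c * Re (opQ_kernel a u x (rowt t)))).
    exact: (integrableD measurableT j1 j2).
  rewrite -(RintegralZl _ measurableT u1) -(RintegralZl _ measurableT u2).
  rewrite -(RintegralD measurableT j1 j2) -(RintegralD measurableT j3 v2).
  by apply: eq_Rintegral => t _; rewrite kE Im_add Im_mul.
Qed.

End opQ.

Section fourier.
Variable n : nat.
Implicit Types (u v : 'rV[R]_n -> R[i]) (x y : 'rV[R]_n).

Let one : 'rV[R]_(n + n) -> R[i] := fun=> 1.

Let symb_cst l (c : R) : `|c| <= 1 -> @symb R n 0 l 1 (fun=> c).
Proof.
by move=> c1 w _ x y; rewrite expr0 mulr1; apply: le_trans (dw_cst _ _ _) c1.
Qed.

Let csymb_one l : csymb 0 l 1 one.
Proof. by split; apply: symb_cst; rewrite ?normr1 ?normr0. Qed.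

Let csymbol_one : csymbol 0 one.
Proof.
split; (split; first exact: smoothr_cst) => l; exists 1.
  exact: (csymb_one l).1.
exact: (csymb_one l).2.
Qed.

(** The reflection is written as scaling by -1 so that the lemmas on dilations apply to it. *)
Lemma fourierE u : fourier u = fun x => opQ one u (-1 *: x).
Proof.
apply/funext => x; rewrite /fourier /opQ; congr cintegral; apply/funext => y.
rewrite /opQ_kernel /one mulr1; congr (cexpi _ * _).
by rewrite /dotrv -sumrN; apply: eq_bigr => i _; rewrite !mxE mulN1r mulNr mulrC.
Qed.

Lemma weightN x : weight (-1 *: x) = weight x.
Proof. by apply: eq_bigr => i _; rewrite mxE mulN1r sqrrN. Qed.

Lemma decayN k l K (f : 'rV[R]_n -> R) : smoothr f -> decay k l K f ->
  decay k l K (fun x => f (-1 *: x)).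
Proof.
move=> sf fK w wl x; rewrite dw_scale// normrM normrX normrN1 expr1n mul1r.
by rewrite -weightN; exact: fK.
Qed.

Lemma cdecayN k l K u : csmooth u -> cdecay k l K u ->
  cdecay k l K (fun x => u (-1 *: x)).
Proof.
by move=> [s1 s2] [u1 u2]; split; [exact: (decayN s1 u1)|exact: (decayN s2 u2)].
Qed.

Lemma fourier_crapid u : crapid u -> crapid (fourier u).
Proof.
move=> su; rewrite fourierE.
have [[s1 q1] [s2 q2]] := opQ_crapid csymbol_one su.
split; split; [exact: (smoothr_scale _ s1)| |exact: (smoothr_scale _ s2)|];
  move=> k l; [have [K H] := q1 k l|have [K H] := q2 k l]; exists K.
- exact: (decayN s1 H).
- exact: (decayN s2 H).
Qed.

(** The constant symbol 1 has growth exponent 0 and all its seminorm bounds equal to 1, so the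
    derivative order of [opQ_decay] becomes 2np: none at all for p = 0, whatever [r]. *)
Lemma fourier_decay p r : exists k C, 0 <= C /\
  forall u K, crapid u -> cdecay k (2 * (n * p)) K u -> cdecay p r (C * K) (fourier u).
Proof.
have [k [l [C [C0 HC]]]] := @opQ_decay n 0 p r.
exists k, C; split=> // u K su du; rewrite fourierE.
apply: cdecayN; first exact/crapid_smooth/(opQ_crapid csymbol_one su).
by have := HC one u 1 K csymbol_one su (csymb_one l) du; rewrite mul1r.
Qed.

Lemma fourier_linear u v (c : R[i]) x : crapid u -> crapid v ->
  fourier (fun y => c * u y + v y) x = c * fourier u x + fourier v x.
Proof. by move=> su sv; rewrite !fourierE (opQ_linear c _ csymbol_one). Qed.

End fourier.

End complex_seminorms.

(** * Nets and their rates *)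

Section words_max.
Variable n : nat.

(** There are finitely many words of length at most [l], so thresholds found word by word have a
    maximum. It turns bounds stated for each multi-index into a bound common to all derivatives up
    to a given order. *)
Lemma words_max (Q : seq 'I_n -> nat -> Prop) :
  (forall w k k', (k <= k')%N -> Q w k -> Q w k') ->
  (forall w, exists k, Q w k) ->
  forall l, exists k, forall w, (size w <= l)%N -> Q w k.
Proof.
move=> mQ exQ l; elim: l Q mQ exQ => [|l IH] Q mQ exQ.
  by have [k Qk] := exQ [::]; exists k => -[].
have [k0 Qk0] := exQ [::].
have /choice[k Qk] i : exists k, forall w, (size w <= l)%N -> Q (i :: w) k.
  apply: (IH (fun w => Q (i :: w))) => [w k k'|w]; first exact: mQ.
  exact: exQ.
exists (maxn k0 (\max_i k i)) => -[_|i w /= wl].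
  by apply: mQ Qk0; exact: leq_maxl.
by apply: mQ (Qk i w wl); rewrite leq_max; apply/orP; right; exact: leq_bigmax.
Qed.

End words_max.

Section monomials.
Variables (R : realType) (n : nat) (I : Type).
Variables (f : I -> 'rV[R]_n -> R) (s : I -> R).
Hypotheses (sf : forall i, smoothr (f i)) (s0 : forall i, 0 <= s i).
Hypothesis Hf : forall alpha beta : multi_index n, exists C : R,
  forall i x, `|monomial alpha x| * `|mi_partial beta (f i) x| <= C * s i.

Let dom (g : 'rV[R]_n -> R) := forall beta : multi_index n, exists C : R,
  forall i x, `|g x| * `|mi_partial beta (f i) x| <= C * s i.

Lemma monomial_sqr (alpha : multi_index n) i (x : 'rV[R]_n) :
  monomial [ffun j => (alpha j + (i == j).*2)%N] x = x 0 i ^+ 2 * monomial alpha x.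
Proof.
rewrite /monomial (bigD1 i)//= [in RHS](bigD1 i)//= ffunE eqxx exprD [RHS]mulrA.
congr (_ * _); first exact: mulrC.
apply: eq_bigr => j ji.
by rewrite ffunE eq_sym (negbTE ji) addn0.
Qed.

Let dom_weight v : forall alpha,
  dom (fun x => \prod_(i <- v) (1 + x 0 i ^+ 2) * monomial alpha x).
Proof.
elim: v => [|i v IH] alpha beta.
  by have [C HC] := Hf alpha beta; exists C => j x; rewrite big_nil mul1r.
have [C HC] := IH alpha beta.
have [C' HC'] := IH [ffun j => (alpha j + (i == j).*2)%N] beta.
exists (C + C') => j x; rewrite mulrDl; apply: le_trans (lerD (HC j x) (HC' j x)).
rewrite -mulrDl ler_wpM2r// monomial_sqr big_cons.
rewrite (_ : (_ * _) * _ = \prod_(i <- v) (1 + x 0 i ^+ 2) * monomial alpha x +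
  \prod_(i <- v) (1 + x 0 i ^+ 2) * (x 0 i ^+ 2 * monomial alpha x)) ?ler_normD//.
by ring.
Qed.

(** A power of the weight is expanded into monomials, one factor 1 + x_i^2 at a time. The index set
    [I] will be that of the nets: the constant is uniform in it, the dependence on eps being carried
    by [s]. *)
Lemma decay_of_monomials k l : exists C, forall i, decay k l (C * s i) (f i).
Proof.
(* Constants are rounded up to naturals, the form in which [words_max] maximises them. *)
pose Q w (c : nat) := forall i x, weight x ^+ k * `|dw w (f i) x| <= c%:R * s i.
have [|w|c Hc] := @words_max n Q _ _ l.
- by move=> w c c' cc H i x; apply: le_trans (H i x) _; rewrite ler_wpM2r// ler_nat.
- have [C HC] := dom_weight (flatten (nseq k (index_enum 'I_n))) [ffun=> 0%N] (mi_of_word w).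
  exists (Num.bound `|C|) => i x; apply: (@le_trans _ _ (C * s i)).
    rewrite dw_mi_partial//; apply: le_trans (HC i x); rewrite prod_weightX.
    rewrite ler_wpM2r// (_ : monomial _ _ = 1); last first.
      by apply: big1 => j _; rewrite ffunE.
    by rewrite mulr1 ler_norm.
  rewrite ler_wpM2r// (le_trans (ler_norm _))// ltW//.
  by rewrite archi_boundP.
- by exists c%:R => i w wl x; exact: Hc.
Qed.

End monomials.

Section Linfty_pointwise.
Variables (R : realType) (n : nat).
Local Notation Re := (@complex.Re R).
Local Notation Im := (@complex.Im R).
Implicit Types (g : 'rV[R]_n -> R) (u : 'rV[R]_n -> R[i]) (beta : multi_index n).

Lemma normc_le_ReIm (z : R[i]) : Normc.normc z <= `|Re z| + `|Im z|.
Proof.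
rewrite normc_sqrt -[leRHS]ger0_norm ?addr_ge0// -sqrtr_sqr ler_wsqrtr//.
rewrite sqrrD !real_normK ?num_real// -addrA [_ *+ 2 + _]addrC addrA lerDl.
by rewrite mulrn_wge0// mulr_ge0.
Qed.

Lemma mi_partial_smoothr beta (f : 'rV[R]_n -> R) : smoothr f -> smoothr (mi_partial beta f).
Proof. by move=> sf; rewrite mi_partialE//; exact: smoothr_dw. Qed.

(** The modulus of the product is continuous, so its essential supremum bounds it at every point,
    and each part is bounded by the modulus. *)
Lemma Linfty_pointwise g u beta (M : R) : continuous g -> csmooth u ->
  (Linfty_norm (fun x => (g x)%:C * cpartial beta u x)%R <= M%:E)%E ->
  forall x, `|g x| * `|mi_partial beta (Re \o u) x| <= M /\
            `|g x| * `|mi_partial beta (Im \o u) x| <= M.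
Proof.
move=> cg [su1 su2] HM x.
set F := (fun x => (g x)%:C * cpartial beta u x) in HM.
have FE y : F y = (g y * mi_partial beta (Re \o u) y) +i*
    (g y * mi_partial beta (Im \o u) y).
  by apply: complex_eq; rewrite /F ?Re_mul ?Im_mul/= !mul0r ?subr0 ?addr0.
have cF : continuous (fun x => Normc.normc (F x)).
  rewrite (_ : (fun x => _) = fun x => Num.sqrt ((g x * mi_partial beta (Re \o u) x) *
     (g x * mi_partial beta (Re \o u) x) + (g x * mi_partial beta (Im \o u) x) *
     (g x * mi_partial beta (Im \o u) x))); last first.
    by apply/funext => y; rewrite FE normc_sqrt !expr2.
  move=> y.
  have c1 := continuousM (cg y) (smoothr_continuous (mi_partial_smoothr beta su1) (x := y)).
  have c2 := continuousM (cg y) (smoothr_continuous (mi_partial_smoothr beta su2) (x := y)).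
  exact: (continuous_comp (continuousD (continuousM c1 c1) (continuousM c2 c2))
    (@sqrt_continuous R _)).
have := le_trans (le_Linfty_norm x cF) HM; rewrite lee_fin => H.
by rewrite -!normrM; split; apply: le_trans H; rewrite FE;
  [exact: (Re_le_normc (_ +i* _))|exact: (Im_le_normc (_ +i* _))].
Qed.

Lemma Linfty_norm_of_pointwise g u beta (M : R) :
  (forall x, `|g x| * `|mi_partial beta (Re \o u) x| <= M /\
             `|g x| * `|mi_partial beta (Im \o u) x| <= M) ->
  (Linfty_norm (fun x => (g x)%:C * cpartial beta u x)%R <= (M + M)%:E)%E.
Proof.
move=> H; apply: Linfty_norm_le => x; have [H1 H2] := H x.
apply: le_trans (normc_le_ReIm _) _; rewrite Re_mul Im_mul /= !mul0r subr0 addr0.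
by rewrite !normrM lerD.
Qed.

End Linfty_pointwise.

Section rates.
Variables (R : realType) (n : nat).
Local Notation Re := (@complex.Re R).
Local Notation Im := (@complex.Im R).
Implicit Types (u : net R n) (s : eps_index R -> R) (e : eps_index R).

Lemma eps_gt0 e : 0 < val e.
Proof. by case: e => r /= /andP[]. Qed.

Lemma eps_le1 e : val e <= 1.
Proof. by case: e => r /= /andP[]. Qed.

Lemma sup_eps_lty (c : eps_index R -> R) (L : eps_index R -> \bar R) :
  (forall e, 0 < c e) -> (sup_eps (fun e => (c e)%:E * L e) < +oo)%E ->
  exists C : R, forall e, (L e <= (C * (c e)^-1)%:E)%E.
Proof.
move=> c0 H.
have [C HC] : exists C : R, (sup_eps (fun e => (c e)%:E * L e) <= C%:E)%E.
  case: (sup_eps _) H => [r _|//|_]; first by exists r.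
  by exists 0; rewrite leNye.
exists C => e; have : ((c e)%:E * L e <= C%:E)%E.
  by apply: le_trans HC; apply: ereal_sup_ubound; exists e.
by rewrite -lee_pdivlMl// mulrC EFinM.
Qed.

Lemma sup_eps_ltyI (C : R) (c : eps_index R -> R) (L : eps_index R -> \bar R) :
  (forall e, 0 < c e) -> (forall e, (L e <= (C * (c e)^-1)%:E)%E) ->
  (sup_eps (fun e => (c e)%:E * L e) < +oo)%E.
Proof.
move=> c0 H; apply: (@le_lt_trans _ _ C%:E); last exact: ltry.
apply: ge_ereal_sup => _ [e _ <-].
by rewrite -lee_pdivlMl// -EFinM mulrC H.
Qed.

Definition rate k l s u := exists C : R, forall e, cdecay k l (C * s e) (u e).

Definition csmooth_net u := forall e, csmooth (u e).

Lemma csmooth_netE u : csmooth_net u <-> smooth_net u.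
Proof. by split=> H e; apply/csmoothE. Qed.

Lemma continuous_monomial alpha : continuous (@monomial R n alpha).
Proof.
apply: smoothr_continuous; rewrite /monomial.
elim: (index_enum _) => [|i r IH].
  rewrite (_ : (fun y => _) = fun=> 1); first exact: smoothr_cst.
  by apply/funext => y; rewrite big_nil.
rewrite (_ : (fun y => _) = fun y : 'rV[R]_n =>
    y 0 i ^+ alpha i * \prod_(i <- r) y 0 i ^+ alpha i).
  apply: smoothrM IH; elim: (alpha i) => [|k IH]; first exact: smoothr_cst.
  rewrite (_ : (fun y => _) = fun y : 'rV[R]_n => y 0 i * y 0 i ^+ k).
    by apply: smoothrM IH; exact: smoothr_coord.
  by apply/funext => y; rewrite exprS.
by apply/funext => y; rewrite big_cons.
Qed.

Lemma monomial_le_weight alpha (x : 'rV[R]_n) :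
  `|monomial alpha x| <= weight x ^+ mi_size alpha.
Proof.
rewrite /monomial normr_prod /mi_size expr_sum; apply: ler_prod => i _.
by rewrite normr_ge0/= normrX lerXn2r ?nnegrE ?weight_ge0// abs_coord_le_weight.
Qed.

Lemma rate_of_Linfty u s k l : csmooth_net u -> (forall e, 0 < s e) ->
  (forall alpha beta : multi_index n, (sup_eps (fun e => ((s e)^-1)%:E *
      Linfty_norm (fun x => (monomial alpha x)%:C * cpartial beta (u e) x)%R)
     < +oo)%E) -> rate k l s u.
Proof.
move=> su s0 H.
have P (alpha beta : multi_index n) : exists C : R, forall e x,
   `|monomial alpha x| * `|mi_partial beta (Re \o u e) x| <= C * s e /\
   `|monomial alpha x| * `|mi_partial beta (Im \o u e) x| <= C * s e.
  have [|C HC] := sup_eps_lty _ (H alpha beta); first by move=> e; rewrite invr_gt0.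
  exists C => e x; apply: Linfty_pointwise => //; first exact: continuous_monomial.
  by have := HC e; rewrite invrK.
have s0' e : 0 <= s e by exact: ltW.
have [|C1 H1] := @decay_of_monomials R n _ (fun e => Re \o u e) s (fun e => (su e).1) s0' _ k l.
  by move=> alpha beta; have [C HC] := P alpha beta; exists C => e x; have [] := HC e x.
have [|C2 H2] := @decay_of_monomials R n _ (fun e => Im \o u e) s (fun e => (su e).2) s0' _ k l.
  by move=> alpha beta; have [C HC] := P alpha beta; exists C => e x; have [] := HC e x.
exists (Num.max C1 C2) => e; split.
  by apply: decayW (H1 e) => //; rewrite ler_wpM2r// le_max lexx.
by apply: decayW (H2 e) => //; rewrite ler_wpM2r// le_max lexx orbT.
Qed.

Lemma Linfty_of_rate u s g k beta : csmooth_net u -> (forall e, 0 < s e) ->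
  (forall x : 'rV[R]_n, `|g x| <= weight x ^+ k) ->
  rate k (size (word_of_mi beta)) s u ->
  (sup_eps (fun e => ((s e)^-1)%:E *
      Linfty_norm (fun x => (g x)%:C * cpartial beta (u e) x)%R) < +oo)%E.
Proof.
move=> su s0 gk [C HC]; apply: (@sup_eps_ltyI (C + C)) => [e|e].
  by rewrite invr_gt0.
rewrite invrK mulrDl; apply: Linfty_norm_of_pointwise => x.
have [[s1 s2] [d1 d2]] := (su e, HC e).
rewrite !mi_partialE//; split.
  by apply: le_trans (d1 _ (leqnn _) x); rewrite ler_wpM2r.
by apply: le_trans (d2 _ (leqnn _) x); rewrite ler_wpM2r.
Qed.

Lemma EinftyS_rate u : EinftyS u <->
  csmooth_net u /\ exists N : nat, forall k l, rate k l (fun e => val e ^- N) u.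
Proof.
have p0 N e : 0 < val e ^- N by rewrite invr_gt0 exprn_gt0// eps_gt0.
split=> [[/csmooth_netE su [N HN]]|[su [N HN]]]; split.
- by [].
- exists N => k l; apply: rate_of_Linfty => // alpha beta.
  by under eq_fun do rewrite invrK; exact: HN.
- exact/csmooth_netE.
- exists N => alpha beta.
  have := Linfty_of_rate su (p0 N) (monomial_le_weight alpha) (HN _ _) (beta := beta).
  by under eq_fun do rewrite invrK.
Qed.

Lemma NegS_rate u : NegS u <->
  csmooth_net u /\ forall q k l, rate k l (fun e => val e ^+ q) u.
Proof.
have p0 q e : 0 < val e ^+ q by rewrite exprn_gt0// eps_gt0.
split=> [[/csmooth_netE su HN]|[su HN]]; split.
- by [].
- by move=> q k l; apply: rate_of_Linfty => // alpha beta; exact: HN.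
- exact/csmooth_netE.
- move=> alpha beta q.
  exact: (Linfty_of_rate su (p0 q) (monomial_le_weight alpha) (HN _ _ _)).
Qed.

Lemma japanese_le_weight (x : 'rV[R]_n) : 1 <= japanese x <= weight x.
Proof.
have d0 : 0 <= dotrv x x by apply: sumr_ge0 => i _; rewrite -expr2 sqr_ge0.
have jE : japanese x ^+ 2 = 1 + dotrv x x.
  by rewrite /japanese /euclid_norm !sqr_sqrtr ?addr_ge0// sqr_ge0.
have j1 : 1 <= japanese x.
  by rewrite -[1]sqrtr1 /japanese ler_wsqrtr// lerDl sqr_ge0.
rewrite j1 /=; apply: (@le_trans _ _ (japanese x ^+ 2)).
  by rewrite expr2 ler_peMl// (le_trans _ j1).
rewrite jE /dotrv /weight; elim: (index_enum _) => [|i r IH].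
  by rewrite !big_nil addr0.
rewrite !big_cons mulrDl mul1r addrCA addrC lerD// -expr2 ler_peMr ?sqr_ge0//.
elim/big_ind: _ => // [a b a1 b1|j _]; first by rewrite -[1]mulr1 ler_pM.
by rewrite lerDl sqr_ge0.
Qed.

Lemma continuous_japanese : continuous (@japanese R n).
Proof.
have -> : @japanese R n = fun x => Num.sqrt (1 + dotrv x x).
  apply/funext => x; rewrite /japanese /euclid_norm sqr_sqrtr//.
  by apply: sumr_ge0 => i _; rewrite -expr2 sqr_ge0.
have c1 : continuous (fun x : 'rV[R]_n => 1 + dotrv x x).
  apply: smoothr_continuous; apply: smoothrD; first exact: smoothr_cst.
  rewrite /dotrv; elim: (index_enum _) => [|i r IH].
    rewrite (_ : (fun y => _) = fun=> 0); first exact: smoothr_cst.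
    by apply/funext => y; rewrite big_nil.
  rewrite (_ : (fun y => _) = fun y : 'rV[R]_n =>
    y 0 i * y 0 i + \sum_(i <- r) y 0 i * y 0 i).
    by apply: smoothrD IH; apply: smoothrM; exact: smoothr_coord.
  by apply/funext => y; rewrite big_cons.
by move=> x; exact: (continuous_comp (c1 x) (@sqrt_continuous R _)).
Qed.

(** The pointwise form in which moderateness is used. A single [N] is the constant, the exponent of
    1/eps and the exponent of the weight, so that [words_max] has one integer to maximise. *)
Definition growth u := csmooth_net u /\
  forall l, exists N : nat, forall e w x, (size w <= l)%N ->
    `|dw w (Re \o u e) x| <= N%:R * val e ^- N * weight x ^+ N /\
    `|dw w (Im \o u e) x| <= N%:R * val e ^- N * weight x ^+ N.

Lemma Etau_growth u : Etau u -> growth u.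
Proof.
move=> [/csmooth_netE su Hu]; split=> // l.
pose Q w (N : nat) := forall e x,
    `|dw w (Re \o u e) x| <= N%:R * val e ^- N * weight x ^+ N /\
    `|dw w (Im \o u e) x| <= N%:R * val e ^- N * weight x ^+ N.
have mono (N N' : nat) e (x : 'rV[R]_n) : (N <= N')%N ->
    N%:R * val e ^- N * weight x ^+ N <= N'%:R * val e ^- N' * weight x ^+ N'.
  move=> NN; have e0 := eps_gt0 e.
  rewrite ler_pM ?mulr_ge0 ?invr_ge0 ?exprn_ge0 ?weight_ge0 ?(ltW e0)//.
    rewrite ler_pM ?invr_ge0 ?exprn_ge0 ?ler_nat ?(ltW e0)//.
    by rewrite lef_pV2 ?posrE ?exprn_gt0// ler_wiXn2l// ?eps_le1// ltW.
  by rewrite ler_weXn2l// weight_ge1.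
have [||N HN] := @words_max n Q _ _ l.
- by move=> w N N' NN H e x; have [H1 H2] := H e x; split;
    [apply: le_trans H1 _|apply: le_trans H2 _]; exact: mono.
- move=> w; have [N HN] := Hu (mi_of_word w).
  have [|C HC] := sup_eps_lty _ HN; first by move=> e; rewrite exprn_gt0// eps_gt0.
  exists (maxn N (Num.bound `|C|)) => e x.
  pose g (x : 'rV[R]_n) := japanese x ^- N.
  have cg : continuous g.
    move=> y.
    have cN : {for y, continuous (fun x : 'rV[R]_n => japanese x ^+ N)}.
      exact: (continuous_comp (@continuous_japanese y) (@exprn_continuous _ _ _)).
    have j0 : japanese y ^+ N != 0.
      rewrite expf_neq0// gt_eqF// (lt_le_trans ltr01)//.
      by case/andP: (japanese_le_weight y).
    exact: (@continuousV R _ (fun x : 'rV[R]_n => japanese x ^+ N) y j0 cN).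
  have := Linfty_pointwise cg (su e) (HC e) x.
  have /andP[j1 jw] := japanese_le_weight x.
  have jN : 0 < japanese x ^+ N by rewrite exprn_gt0// (lt_le_trans ltr01).
  rewrite ger0_norm ?invr_ge0 ?(ltW jN)// -!dw_mi_partial; [|exact: (su e).2|exact: (su e).1].
  rewrite ![(japanese x ^+ N)^-1 * _]mulrC !ler_pdivrMr// => -[H1 H2].
  suff B : C * (val e ^+ N)^-1 * japanese x ^+ N <=
     (maxn N (Num.bound `|C|))%:R * val e ^- (maxn N (Num.bound `|C|)) *
     weight x ^+ (maxn N (Num.bound `|C|)).
    by split; [exact: le_trans H1 B|exact: le_trans H2 B].
  have e0 := eps_gt0 e.
  apply: (@le_trans _ _ ((maxn N (Num.bound `|C|))%:R * val e ^- N * weight x ^+ N)).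
    apply: (@le_trans _ _ (`|C| * (val e ^+ N)^-1 * japanese x ^+ N)).
      by rewrite ler_wpM2r ?(ltW jN)// ler_wpM2r ?ler_norm// invr_ge0 exprn_ge0// ltW.
    rewrite ler_pM ?mulr_ge0 ?invr_ge0 ?exprn_ge0 ?(ltW e0)//.
    - by rewrite (le_trans _ j1).
    - rewrite ler_wpM2r ?invr_ge0 ?exprn_ge0 ?(ltW e0)//.
      apply: (@le_trans _ _ (Num.bound `|C|)%:R); first by rewrite ltW// archi_boundP.
      by rewrite ler_nat leq_maxr.
    - by rewrite lerXn2r ?nnegrE ?weight_ge0// (le_trans _ j1).
  rewrite ler_pM ?mulr_ge0 ?invr_ge0 ?exprn_ge0 ?weight_ge0 ?(ltW e0)//.
    rewrite ler_wpM2l// lef_pV2 ?posrE ?exprn_gt0// ler_wiXn2l ?eps_le1 ?leq_maxl//.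
    exact: ltW.
  by rewrite ler_weXn2l ?weight_ge1// leq_maxl.
by exists N => e w x wl; exact: HN.
Qed.

(** Bounded derivatives suffice since japanese^-N <= 1. The images under the operator decay rapidly,
    so this weak criterion is enough for them. *)
Lemma rate_Etau u : csmooth_net u ->
  (forall l, exists N : nat, rate 0 l (fun e => val e ^- N) u) -> Etau u.
Proof.
move=> su H; split; first exact/csmooth_netE.
move=> alpha; have [N HN] := H (size (word_of_mi alpha)); exists N.
have p0 e : 0 < val e ^- N by rewrite invr_gt0 exprn_gt0// eps_gt0.
have := @Linfty_of_rate u (fun e => val e ^- N) (fun x => japanese x ^- N) 0 alpha su p0 _ HN.
under eq_fun do rewrite invrK; apply=> x; rewrite expr0.
have /andP[j1 _] := japanese_le_weight x.
rewrite ger0_norm ?invr_ge0 ?exprn_ge0 ?(le_trans _ j1)//.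
by rewrite invf_le1 ?exprn_ege1// exprn_gt0// (lt_le_trans ltr01).
Qed.

Lemma EinftyS_Etau u : EinftyS u -> Etau u.
Proof.
move=> /EinftyS_rate[su [N HN]]; apply: rate_Etau => // l.
by exists N; exact: HN.
Qed.

End rates.

(** * The pseudo-differential operator *)

Section symbols.
Variables (R : realType) (n : nat).

Lemma weight_row_mx (x y : 'rV[R]_n) : weight (row_mx x y) = weight x * weight y.
Proof.
rewrite /weight big_split_ord /=; congr (_ * _); apply: eq_bigr => i _.
  by rewrite row_mxEl.
by rewrite row_mxEr.
Qed.

(** For t >= 0 the upper bound of Lambda by the japanese bracket is used; for t < 0, the lower bound
    Lambda >= 1 / c1, which follows from japanese^mu >= 1. *)
Lemma weight_function_powR p (Lambda : 'rV[R]_p -> R) (M : nat) (t : R) :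
  weight_function Lambda -> t <= M%:R ->
  exists2 D : R, 0 <= D & forall z, Lambda z `^ t <= D * weight z ^+ M.
Proof.
move=> [_ [mu [mu0 [[c1 c10 H1] [c2 c20 H2]] _ _]]] tM.
(* One summand for each sign of [t]. In the second, 1 + c2 makes the base (1 + c2) weight at least
   1, so that the exponent [t] may be raised to [M]. *)
exists ((1 + c1) `^ `|t| + (1 + c2) ^+ M).
  by rewrite addr_ge0 ?powR_ge0// exprn_ge0// addr_ge0// ltW.
move=> z; have /andP[j1 jw] := japanese_le_weight z.
have w1 := weight_ge1 z.
have pow1 (s : R) : 1 = 1 `^ s by rewrite powR1.
have L1 : 1 <= c1 * Lambda z.
  apply: le_trans (H1 z I); rewrite [leLHS](pow1 mu).
  by rewrite ge0_ler_powR ?nnegrE ?(ltW mu0)// (le_trans _ j1).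
have L0 : 0 < Lambda z by rewrite -(pmulr_rgt0 _ c10) (lt_le_trans ltr01).
rewrite mulrDl.
have [t0|t0] := leP 0 t.
  rewrite ler_wpDl ?mulr_ge0 ?powR_ge0 ?exprn_ge0 ?weight_ge0//.
  have B1 : 1 <= (1 + c2) * weight z.
    by rewrite (le_trans w1)// ler_peMl ?weight_ge0// lerDl (ltW c20).
  apply: (@le_trans _ _ (((1 + c2) * weight z) `^ t)).
    rewrite ge0_ler_powR ?nnegrE ?(ltW L0) ?(le_trans ler01 B1)//.
    rewrite (le_trans (H2 z I))// ler_pM ?(ltW c20) ?(le_trans _ j1)//.
    by rewrite lerDr.
  apply: (@le_trans _ _ (((1 + c2) * weight z) `^ M%:R)); first exact: ler_powR.
  by rewrite powR_mulrn ?(le_trans ler01 B1)// exprMn.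
rewrite ler_wpDr ?mulr_ge0 ?exprn_ge0 ?weight_ge0 ?addr_ge0 ?(ltW c20)//.
apply: (@le_trans _ _ ((1 + c1) `^ `|t|)); last first.
  by rewrite ler_peMr ?powR_ge0// exprn_ege1.
rewrite ltr0_norm// -[t in leLHS]opprK powRN.
rewrite -[leLHS]mul1r ler_pdivrMr ?powR_gt0// -powRM ?(ltW L0) ?addr_ge0 ?(ltW c10)//.
rewrite [leLHS](pow1 (- t)) ge0_ler_powR ?nnegrE ?oppr_ge0 ?(ltW t0)//.
  by rewrite mulr_ge0 ?(ltW L0) ?addr_ge0 ?(ltW c10).
by rewrite (le_trans L1)// ler_wpM2r ?(ltW L0)// lerDr.
Qed.

(** The exponents m - rho |alpha| are all at most m, so one natural number above |m| serves every
    derivative; the exponent [N] of 1/eps is inherited unchanged. *)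
Lemma regular_symbol_csymb (Lambda : 'rV[R]_(n + n) -> R) (m rho : R) (N : nat)
    (a : net R (n + n)) :
  weight_function Lambda -> 0 <= rho -> regular_symbol Lambda m rho N a ->
  exists M, (forall e, csymbol M (a e)) /\
    forall l, exists C, forall e, csymb M l (C * val e ^- N) (a e).
Proof.
move=> wL rho0 [/csmooth_netE sa Ha]; pose M := Num.bound `|m|.
have mM : m <= M%:R by rewrite (le_trans (ler_norm _))// ltW// archi_boundP.
suff H l : exists C : R, forall e, csymb M l (C * val e ^- N) (a e).
  exists M; split=> // e; split; split; [exact: (sa e).1| |exact: (sa e).2|] => l;
  by have [C HC] := H l; exists (C * val e ^- N); have [] := HC e.
pose Q w (c : nat) := forall e x y,
  Normc.normc (cpartial (mi_of_word w) (a e) (row_mx x y)) <=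
  c%:R * val e ^- N * (weight x * weight y) ^+ M.
have eN (e : eps_index R) : 0 <= val e ^- N by rewrite invr_ge0 exprn_ge0// (ltW (eps_gt0 e)).
have [||c Hc] := @words_max (n + n) Q _ _ l.
- move=> w c c' cc H e x y; apply: le_trans (H e x y) _.
  rewrite ler_wpM2r ?exprn_ge0 ?mulr_ge0 ?weight_ge0// ler_wpM2r//.
  by rewrite ler_nat.
- move=> w; have [c c0 Hc] := Ha (mi_of_word w).
  have [|D D0 HD] := @weight_function_powR _ Lambda M (m - rho * (mi_size (mi_of_word w))%:R) wL.
    by rewrite (le_trans _ mM)// gerBl mulr_ge0.
  exists (Num.bound (c * D)) => e x y; apply: le_trans (Hc e _) _.
  rewrite -weight_row_mx [leRHS]mulrAC ler_wpM2r//.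
  apply: (@le_trans _ _ (c * (D * weight (row_mx x y) ^+ M))).
    by rewrite ler_wpM2l// ltW.
  rewrite mulrA ler_wpM2r ?exprn_ge0 ?weight_ge0// ltW// archi_boundP//.
  by rewrite mulr_ge0// ltW.
exists c%:R => e; split=> w wl x y.
  rewrite dw_mi_partial; last exact: (sa e).1.
  by apply: le_trans (Hc w wl e x y); exact: (Re_le_normc (_ +i* _)).
rewrite dw_mi_partial; last exact: (sa e).2.
by apply: le_trans (Hc w wl e x y); exact: (Im_le_normc (_ +i* _)).
Qed.

End symbols.

(** * The mollifier, multiplication by its Fourier transform, and the operator on nets *)

Section mollified.
Variables (R : realType) (n : nat) (phi : 'rV[R]_n -> R[i]).
Hypothesis sphi : schwartz phi.
Local Notation Re := (@complex.Re R).
Local Notation Im := (@complex.Im R).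
Implicit Types (e : eps_index R) (u v : net R n) (k l p r : nat).

Let eps1 : eps_index R.
Proof. by exists 1; rewrite ltr01 lexx. Defined.

(** The comparison proved for nets is applied to the constant net [phi] with rate 1, and read off at
    the index [eps1]. *)
Lemma schwartz_crapid : crapid phi.
Proof.
have [s H] := sphi; have /csmoothE sp := s.
apply: crapidP => // k l.
have [|//|alpha beta|C HC] := @rate_of_Linfty R n (fun=> phi) (fun=> 1) k l.
- by [].
- apply: le_lt_trans (H alpha beta); apply: ge_ereal_sup => _ [e _ <-].
  by rewrite invr1 mul1e.
- by exists (C * 1); exact: HC eps1.
Qed.

Lemma weight_scale (s : R) (x : 'rV[R]_n) : 1 <= s -> weight x <= weight (s *: x).
Proof.
move=> s1; apply: ler_prod => i _; rewrite addr_ge0 ?sqr_ge0//= lerD2l mxE.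
by rewrite exprMn ler_peMl ?sqr_ge0// exprn_ege1.
Qed.

Lemma decay_scale k l K (s : R) (f : 'rV[R]_n -> R) : 1 <= s -> smoothr f ->
  decay k l K f -> decay k l (s ^+ l * K) (fun x => f (s *: x)).
Proof.
move=> s1 sf fK w wl x; have s0 : 0 <= s by rewrite (le_trans _ s1).
rewrite dw_scale// normrM ger0_norm ?exprn_ge0// mulrCA.
apply: ler_pM; [exact: exprn_ge0| |exact: ler_weXn2l|].
  by rewrite mulr_ge0// exprn_ge0// weight_ge0.
apply: le_trans (fK w wl (s *: x)); rewrite ler_wpM2r// lerXn2r ?nnegrE ?weight_ge0//.
exact: weight_scale.
Qed.

Lemma scaledE e : (Re \o scaled phi e = fun x => val e ^- n * (Re \o phi) ((val e)^-1 *: x)) /\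
  (Im \o scaled phi e = fun x => val e ^- n * (Im \o phi) ((val e)^-1 *: x)).
Proof.
by split; apply/funext => x; rewrite /scaled /= ?Re_mul ?Im_mul /= mul0r ?subr0 ?addr0.
Qed.

Lemma scaled_csmooth e : csmooth (scaled phi e).
Proof.
have [[s1 _] [s2 _]] := schwartz_crapid; have [E1 E2] := scaledE e.
split; rewrite ?E1 ?E2; apply: smoothrZ; first exact: (smoothr_scale _ s1).
exact: (smoothr_scale _ s2).
Qed.

(** The exponent [n] comes from the normalisation and [l] from the derivatives of phi(x/eps). Decay
    costs nothing: as 1/eps >= 1, the weight at x is at most the weight at x/eps. *)
Lemma scaled_decay k l K e : cdecay k l K phi ->
  cdecay k l (K * val e ^- (n + l)) (scaled phi e).
Proof.
move=> [d1 d2]; have [[s1 _] [s2 _]] := schwartz_crapid.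
have e1 : 1 <= (val e)^-1 by rewrite invf_ge1 ?eps_le1 ?eps_gt0.
have [E1 E2] := scaledE e.
have -> : K * val e ^- (n + l) = `|val e ^- n| * ((val e)^-1 ^+ l * K).
  rewrite ger0_norm ?invr_ge0 ?exprn_ge0 ?(ltW (eps_gt0 e))//.
  by rewrite exprD invfM exprVn mulrC mulrA.
by split; rewrite ?E1 ?E2; apply: decayZ;
  [exact: (smoothr_scale _ s1)|exact: decay_scale|exact: (smoothr_scale _ s2)|exact: decay_scale].
Qed.

Lemma scaled_crapid e : crapid (scaled phi e).
Proof.
apply: crapidP => [|k l]; first exact: scaled_csmooth.
have [K dK] := crapid_ex k l schwartz_crapid.
by exists (K * val e ^- (n + l)); exact: scaled_decay.
Qed.

Definition phihat : net R n := fun e => fourier (scaled phi e).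

Lemma phihat_crapid e : crapid (phihat e).
Proof. exact/fourier_crapid/scaled_crapid. Qed.

(** Decay of order [p] is paid for by 2np derivatives of the scaled mollifier, so the loss grows
    with [p]. *)
Lemma phihat_rate p r : exists N, rate p r (fun e => val e ^- N) phihat.
Proof.
have [k [C [C0 HC]]] := @fourier_decay R n p r.
have [K dK] := crapid_ex k (2 * (n * p)) schwartz_crapid.
exists (n + 2 * (n * p))%N, (C * K) => e; rewrite -mulrA.
apply: HC; [exact: scaled_crapid|exact: scaled_decay].
Qed.

(* The loss in [eps] does not depend on the order of the derivative: no
   derivative falls on the mollifier, as [2 * (n * 0) = 0]. *)
Lemma phihat_rate0 r : rate 0 r (fun e => val e ^- n) phihat.
Proof.
have [k [C [C0 HC]]] := @fourier_decay R n 0 r.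
have [K dK] := crapid_ex k (2 * (n * 0)) schwartz_crapid.
exists (C * K) => e; rewrite -mulrA.
apply: HC; first exact: scaled_crapid.
by have := scaled_decay e dK; rewrite !muln0 addn0.
Qed.

Definition cutoff u : net R n := fun e x => u e x * phihat e x.

Lemma cutoff_csmooth u : csmooth_net u -> csmooth_net (cutoff u).
Proof. by move=> su e; apply: csmoothM => //; exact/crapid_smooth/phihat_crapid. Qed.

(** Here the growth weight^N of u is beaten by decay of order [k + N] of [phihat]. The exponent of
    1/eps obtained depends on [k] and [l], which is acceptable for moderate nets only. *)
Lemma cutoff_growth u : growth u ->
  forall k l, exists N, rate k l (fun e => val e ^- N) (cutoff u).
Proof.
move=> [su Hu] k l; have [N HN] := Hu l.
have [N' [C HC]] := phihat_rate (k + N) l.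
exists (N + N')%N, (2 * (2 ^+ l * (N%:R * C))) => e.
have := cdecayM (su e) (crapid_smooth (phihat_crapid e)) _ (fun w x wl => HN e w x wl) (HC e).
have eN : 0 <= N%:R * val e ^- N.
  by rewrite mulr_ge0 ?invr_ge0 ?exprn_ge0 ?(ltW (eps_gt0 e)).
move=> /(_ eN); congr cdecay; rewrite exprD invfM; ring.
Qed.

Lemma cutoff_crapid u e : growth u -> crapid (cutoff u e).
Proof.
move=> gu; apply: crapidP => [|k l]; first exact: cutoff_csmooth gu.1 e.
by have [N [C HC]] := cutoff_growth gu k l; exists (C * val e ^- N).
Qed.

(** The roles are exchanged with respect to [cutoff_growth]: u supplies the decay and [phihat] is
    merely a bounded factor, so [phihat_rate0] applies and the loss eps^-n is the same for all [k]
    and [l]. *)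
Lemma cutoff_rate k l (s : eps_index R -> R) u : csmooth_net u ->
  rate k l s u -> rate k l (fun e => s e * val e ^- n) (cutoff u).
Proof.
move=> su [C HC]; have [C' HC'] := phihat_rate0 l.
exists (2 * (2 ^+ l * (C' * C))) => e.
have C0 := cdecay_ge0 (HC' e).
have HG w x : (size w <= l)%N ->
    `|dw w (Re \o phihat e) x| <= C' * val e ^- n * weight x ^+ 0 /\
    `|dw w (Im \o phihat e) x| <= C' * val e ^- n * weight x ^+ 0.
  move=> wl; have [d1 d2] := HC' e.
  by have := (d1 w wl x, d2 w wl x); rewrite !expr0 !mul1r mulr1 => -[].
have D : cdecay (k + 0) l (C * s e) (u e) by rewrite addn0; exact: HC.
have := cdecayM (crapid_smooth (phihat_crapid e)) (su e) C0 HG D.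
rewrite (_ : (fun x => _) = cutoff u e); last by apply/funext => x; exact: mulrC.
congr cdecay; ring.
Qed.

Section psido.
Variables (a : net R (n + n)) (M N : nat).
Hypothesis sa : forall e, csymbol M (a e).
Hypothesis Ha : forall l, exists C, forall e, csymb M l (C * val e ^- N) (a e).
Local Notation T := (psido_net phi a).

Lemma psido_netE u e : T u e =
  fun x => ((2 * pi) ^- n)%:C * opQ (a e) (fourier (cutoff u e)) x.
Proof. by []. Qed.

Lemma psido_csmooth u : growth u -> csmooth_net (T u).
Proof.
move=> gu e; rewrite psido_netE; apply: csmoothM; first exact: csmooth_cst.
exact/crapid_smooth/(opQ_crapid (sa e))/fourier_crapid/cutoff_crapid.
Qed.

(** Orders are chosen backwards: [opQ_decay] dictates what is asked of the Fourier transform, and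
    [fourier_decay] what is asked of the cutoff net. Neither step involves eps, so the only loss is
    the eps^-N of the symbol. *)
Lemma psido_rate p r : exists k l, forall u (s : eps_index R -> R), growth u ->
  rate k l s (cutoff u) -> rate p r (fun e => s e * val e ^- N) (T u).
Proof.
have [k1 [l1 [C1 [C10 H1]]]] := @opQ_decay R n M p r.
have [k2 [C2 [C20 H2]]] := @fourier_decay R n k1 (2 * (n * (M + p))).
have [Ca HCa] := Ha l1.
exists k2, (2 * (n * k1))%N => u s gu [C HC].
pose kappa : R[i] := ((2 * pi) ^- n)%:C.
exists (2 * (2 ^+ r * (Normc.normc kappa * (C1 * (Ca * (C2 * C)))))) => e.
have fc := fourier_crapid (cutoff_crapid e gu).
have := H2 _ _ (cutoff_crapid e gu) (HC e) => /(H1 _ _ _ _ (sa e) fc (HCa e)).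
move=> /(cdecayZ kappa (crapid_smooth (opQ_crapid (sa e) fc))).
rewrite psido_netE; congr cdecay; ring.
Qed.

Lemma growth_lincomb (c : R[i]) u v : growth u -> growth v -> growth (lincomb c u v).
Proof.
move=> [su Hu] [sv Hv]; split.
  by move=> e; apply: csmoothD (sv e); apply: csmoothM (su e); exact: csmooth_cst.
move=> l; have [[N1 HN1] [N2 HN2]] := (Hu l, Hv l).
pose c0 := Num.bound (`|Re c| + `|Im c|).
(* As a constant it must dominate c0 N1 + N2, the bound for the combination; as an exponent it must
   dominate [N1] and [N2]. *)
pose N0 := (N1 + N2 + c0 * N1)%N.
have mono e (x : 'rV[R]_n) (N1' : nat) (d : nat) : (N1' <= N0)%N ->
    d%:R * val e ^- N1' * weight x ^+ N1' <= d%:R * (val e ^- N0 * weight x ^+ N0).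
  move=> NN; have e0 := eps_gt0 e; rewrite -mulrA ler_wpM2l//.
  rewrite ler_pM ?invr_ge0 ?exprn_ge0 ?weight_ge0 ?(ltW e0)//.
    by rewrite lef_pV2 ?posrE ?exprn_gt0// ler_wiXn2l ?eps_le1// ltW.
  by rewrite ler_weXn2l// weight_ge1.
have N1N : (N1 <= N0)%N by rewrite /N0 -addnA leq_addr.
have N2N : (N2 <= N0)%N by rewrite /N0 addnAC leq_addl.
exists N0 => e w x wl.
have [u1 u2] := HN1 e w x wl; have [v1 v2] := HN2 e w x wl.
have {}u1 := le_trans u1 (mono e x _ _ N1N).
have {}u2 := le_trans u2 (mono e x _ _ N1N).
have {}v1 := le_trans v1 (mono e x _ _ N2N).
have {}v2 := le_trans v2 (mono e x _ _ N2N).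
have [[su1 su2] [sv1 sv2]] := (su e, sv e).
rewrite -mulrA; set B := _ * weight x ^+ N0 in u1 u2 v1 v2 *.
have B0 : 0 <= B.
  by rewrite mulr_ge0 ?invr_ge0 ?exprn_ge0 ?weight_ge0 ?(ltW (eps_gt0 e)).
have key (p q : R) (f g h : 'rV[R]_n -> R) : smoothr f -> smoothr g -> smoothr h ->
    `|p| + `|q| <= c0%:R ->
    `|dw w f x| <= N1%:R * B -> `|dw w g x| <= N1%:R * B -> `|dw w h x| <= N2%:R * B ->
    `|dw w (fun x => p * f x + q * g x + h x) x| <= N0%:R * B.
  move=> sf sg sh pq fB gB hB.
  rewrite dwD ?dwD ?dwZ//; try by do ?apply: smoothrD; exact: smoothrZ.
  apply: le_trans (ler_normD _ _) _.
  apply: (@le_trans _ _ (c0%:R * (N1%:R * B) + N2%:R * B)); last first.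
    by rewrite mulrA -mulrDl ler_wpM2r// -natrM -natrD ler_nat /N0 addnC -addnA leq_addl.
  apply: lerD => //; apply: le_trans (ler_normD _ _) _; rewrite !normrM.
  apply: (@le_trans _ _ ((`|p| + `|q|) * (N1%:R * B))).
    by rewrite mulrDl lerD// ler_wpM2l.
  by rewrite ler_wpM2r// mulr_ge0.
have c0P : `|Re c| + `|Im c| <= c0%:R by rewrite ltW// archi_boundP// addr_ge0.
split.
- rewrite (_ : _ \o _ = fun x => Re c * Re (u e x) + (- Im c) * Im (u e x) + Re (v e x)).
    by apply: (key _ _ _ _ _ su1 su2 sv1) => //; rewrite normrN.
  by apply/funext => y; rewrite /lincomb /= Re_add Re_mul mulNr.
- rewrite (_ : _ \o _ = fun x => Re c * Im (u e x) + Im c * Re (u e x) + Im (v e x)).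
    exact: (key _ _ _ _ _ su2 su1 sv2).
  by apply/funext => y; rewrite /lincomb /= Im_add Im_mul.
Qed.

Lemma psido_lincomb (c : R[i]) u v : growth u -> growth v ->
  T (lincomb c u v) = lincomb c (T u) (T v).
Proof.
move=> gu gv; apply/funext => e; apply/funext => x.
have [cu cv] := (cutoff_crapid e gu, cutoff_crapid e gv).
rewrite /lincomb !psido_netE.
have -> : cutoff (lincomb c u v) e = fun y => c * cutoff u e y + cutoff v e y.
  by apply/funext => y; rewrite /cutoff /lincomb mulrDl mulrA.
have -> : fourier (fun y => c * cutoff u e y + cutoff v e y) =
    fun y => c * fourier (cutoff u e) y + fourier (cutoff v e) y.
  by apply/funext => y; exact: fourier_linear.
rewrite (@opQ_linear R n M (a e) _ _ c x (sa e) (fourier_crapid cu) (fourier_crapid cv)).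
by rewrite mulrDr mulrCA.
Qed.

(** The exponent adds the rate of u, the loss of [phihat] and that of the symbol. None of the three
    depends on [p] or [r], which is what regularity demands. *)
Lemma psido_EinftyS u : EinftyS u -> EinftyS (T u).
Proof.
move=> Eu; have gu : growth u by exact/Etau_growth/EinftyS_Etau.
have [su [N' HN']] := (EinftyS_rate u).1 Eu.
apply/EinftyS_rate; split; first exact: psido_csmooth.
exists (N' + n + N)%N => p r; have [k [l Hkl]] := psido_rate p r.
have [C HC] := Hkl u _ gu (cutoff_rate su (HN' k l)).
by exists C => e; have := HC e; rewrite !exprD !invfM.
Qed.

(** The exponent supplied by [cutoff_growth] depends on [r]; moderateness permits this, its [N]
    being chosen after the derivative. *)
Lemma psido_Etau u : Etau u -> Etau (T u).
Proof.
move=> /Etau_growth gu; apply: rate_Etau; first exact: psido_csmooth.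
move=> r; have [k [l Hkl]] := psido_rate 0 r.
have [N' HN'] := cutoff_growth gu k l.
exists (N' + N)%N; have [C HC] := Hkl u _ gu HN'.
by exists C => e; have := HC e; rewrite exprD invfM.
Qed.

Lemma psido_NegS u : growth u -> NegS u -> NegS (T u).
Proof.
move=> gu /NegS_rate[su Hu]; apply/NegS_rate; split; first exact: psido_csmooth.
move=> q p r; have [k [l Hkl]] := psido_rate p r.
(* Starting from the rate eps^(q+n+N) compensates in advance the fixed losses eps^-n and eps^-N. *)
have [C HC] := Hkl u _ gu (cutoff_rate su (Hu (q + n + N)%N k l)).
exists C => e; have := HC e; congr cdecay; congr (_ * _).
have e0 : val e != 0 by rewrite gt_eqF// eps_gt0.
rewrite !exprD; field; by rewrite !expf_neq0.
Qed.

End psido.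
End mollified.

(** * Cosets modulo negligible nets *)

Section classes.
Variables (R : realType) (n : nat).
Implicit Types u v : net R n.

Lemma NegS0 : NegS (fun (e : eps_index R) (x : 'rV[R]_n) => 0).
Proof.
apply/NegS_rate; split=> [e|q k l]; first exact: csmooth_cst.
exists 0 => e; rewrite mul0r; split=> w _ x;
  rewrite (_ : `|_| = 0) ?mulr0//; apply/eqP; rewrite -normr_le0 normr_id;
  by apply: le_trans (dw_cst _ _ _) _; rewrite normr0.
Qed.

Lemma NegS_lincomb (c : R[i]) u v : NegS u -> NegS v -> NegS (lincomb c u v).
Proof.
move=> /NegS_rate[su Hu] /NegS_rate[sv Hv]; apply/NegS_rate; split.
  by move=> e; apply: csmoothD (sv e); apply: csmoothM (su e); exact: csmooth_cst.
move=> q k l; have [[C HC] [C' HC']] := (Hu q k l, Hv q k l).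
exists (2 * (2 ^+ l * (Normc.normc c * C)) + C') => e.
have := cdecayD (csmoothM (csmooth_cst _ c) (su e)) (sv e) (cdecayZ c (su e) (HC e)) (HC' e).
congr cdecay; ring.
Qed.

Lemma classS_eq u v : classS u = classS v <-> NegS (fun e x => v e x - u e x).
Proof.
split=> [E|H].
  have : classS v v.
    rewrite /classS /= (_ : (fun e x => _) = fun=> fun=> 0); first exact: NegS0.
    by apply/funext => e; apply/funext => x; rewrite subrr.
  by rewrite -E.
apply/seteqP; split=> w /= Hw.
  have := NegS_lincomb (-1) H Hw; congr NegS.
  by apply/funext => e; apply/funext => x; rewrite /lincomb; ring.
have := NegS_lincomb 1 H Hw; congr NegS.
by apply/funext => e; apply/funext => x; rewrite /lincomb; ring.
Qed.

End classes.

Theorem proposition5p6 (R : realType) (n : nat)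
    (phi : 'rV[R]_n -> R[i]) (Lambda : 'rV[R]_(n + n) -> R)
    (m rho : R) (N : nat) (a : net R (n + n))
    (hphi : mollifier phi) (hLambda : weight_function Lambda)
    (hrho : 0 < rho <= 1) (ha : regular_symbol Lambda m rho N a) :
  exists A : set (net R n) -> set (net R n),
    [/\ psido_operator phi a A,
        forall U, GtauS U -> GtauS (A U) &
        forall U, GinftyS U -> GinftyS (A U)].
Proof.
have [sphi _ _] := hphi.
have rho0 : 0 <= rho by case/andP: hrho => /ltW.
have [M [sa Ha]] := regular_symbol_csymb hLambda rho0 ha.
pose T := psido_net phi a.
(* The operator acts on sets of nets, so a representative is chosen in each class, with the zero net
   as default. It is required to satisfy [growth], the property on which the estimates rest. *)
pose rep (U : set (net R n)) : net R n :=
  xget (fun=> fun=> 0) [set u | growth u /\ classS u = U].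
pose A U := classS (T (rep U)).
have AE u : growth u -> A (classS u) = classS (T u).
  move=> gu; have : [set v | growth v /\ classS v = classS u] (rep (classS u)).
    by apply: xgetPex; exists u.
  move=> /= [gr /esym/classS_eq Nr]; apply/esym/classS_eq.
  have E : lincomb (-1) u (rep (classS u)) =
      fun e x => rep (classS u) e x - u e x.
    by apply/funext => e; apply/funext => x; rewrite /lincomb; ring.
  (* Independence of the representative: the difference between the chosen one and u is negligible
     and of moderate growth, so its image is negligible, and by linearity that image is the
     difference of the two images. *)
  have := psido_NegS sphi sa Ha (growth_lincomb (-1) gu gr).
  rewrite E => /(_ Nr); rewrite -E (psido_lincomb sphi sa _ gu gr); congr NegS.
  by apply/funext => e; apply/funext => x; rewrite /lincomb mulN1r addrC.
exists A; split.
- split=> [u /Etau_growth gu|c u v /Etau_growth gu /Etau_growth gv].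
    exact: AE.
  rewrite AE; last exact: growth_lincomb.
  by rewrite /T (psido_lincomb sphi sa _ gu gv).
- move=> _ [u Eu <-]; rewrite (AE _ (Etau_growth Eu)).
  by exists (T u) => //; exact: (psido_Etau sphi sa Ha).
- move=> _ [u Eu <-]; rewrite (AE _ (Etau_growth (EinftyS_Etau Eu))).
  by exists (T u) => //; exact: (psido_EinftyS sphi sa Ha).
Qed.
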